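(* Let $(U,\mathcal{F})$ be a convex geometry belonging to one of the following classes: (1) double-shelling convex geometries; (2) acyclic convex geometries; (3) affine convex geometries; (4) acceptant convex geometries. Then for every essential set $C$ of $(U,\mathcal{F})$, the quasi-closed hypergraph $\mathcal{Q}(C)$ has pairwise disjoint edges. Consequently, an implicational base of a convex geometry in any of these classes can be optimized in polynomial time (i.e., there is a polynomial-time algorithm turning it into an equivalent implicational base of minimum total size).
   Context: All sets are finite. A closure system is a pair $(U,\mathcal{F})$ with $\mathcal{F}\subseteq 2^U$, $U\in\mathcal{F}$, closed under intersection; closure operator $\phi(A)=\bigcap\{C\in\mathcal{F}:A\subseteq C\}$. $(U,\mathcal{F})$ is a convex geometry if $\emptyset\in\mathcal{F}$ and for every closed $C\subsetneq U$ there is $x\notin C$ with $C\cup\{x\}$ closed. $\mathrm{ex}(A)=\{x\in A: x\notin\phi(A\setminus\{x\})\}$. A set $Q$ is quasi-closed if $Q$ is not closed and for every $A\subseteq Q$, $\phi(A)\subsetneq\phi(Q)$ implies $\phi(A)\subseteq Q$. A closed set $C$ is essential if $C=\phi(Q)$ for some quasi-closed $Q$; quasi-closed sets of $C$ are those with closure $C$. The quasi-closed hypergraph $\mathcal{Q}(C)$ has vertex set $C$ and edges $C\setminus Q$ for $Q$ an inclusion-wise maximal quasi-closed set of $C$. An implication is $A\to B$ ($A,B\subseteq U$), satisfied by $X$ if $A\subseteq X\Rightarrow B\subseteq X$; $(U,\Sigma)$ is an implicational base of $(U,\mathcal{F})$ if $\mathcal{F}$ is exactly the family of subsets satisfying all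 of $\Sigma$; total size is $\sum_{A\to B\in\Sigma}(|A|+|B|)$ and optimizing means producing an equivalent base of minimum total size. Classes: (1) for a finite poset $(U,\le)$, a set $C$ is convex if $x,y\in C$, $x<y$ imply $\{z: x\le z\le y\}\subseteq C$; the family of convex sets is the double-shelling convex geometry of the poset. (2) The implication-graph of $(U,\Sigma)$ is the directed graph on $U$ with an arc $(a,b)$ whenever some $A\to B\in\Sigma$ has $a\in A$, $b\in B$ (with $A\cap B=\emptyset$ assumed); a closure system is acyclic if it admits an implicational base whose implication-graph has no directed cycle. (3) For a finite set $U\subseteq\mathbb{R}^d$, the closure operator $\phi(Y)=\mathrm{conv}(Y)\cap U$ defines the affine convex geometry of $U$. (4) A convex geometry is $q$-acceptant ($1\le q\le |U|$) if $|\mathrm{ex}(C)|=\min(q,|C|)$ for every closed $C$; it is acceptant if it is $q$-acceptant for some $q$. *)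

(* Defs.v *)
From HB Require Import structures.
From mathcomp Require Import all_boot all_order all_algebra reals.

Set Implicit Arguments.
Unset Strict Implicit.
Unset Printing Implicit Defensive.

Import GRing.Theory Num.Theory.

Section ClosureSystems.
Variable U : finType.
Implicit Types (F : {set {set U}}) (A C Q X : {set U}).

Definition closure_system F : Prop :=
  [set: U] \in F /\ {in F &, forall A B, A :&: B \in F}.

Definition clos F A : {set U} := \bigcap_(C in F | A \subset C) C.

Definition convex_geometry F : Prop :=
  [/\ closure_system F, set0 \in F &
      {in F, forall C, C != [set: U] -> exists2 x, x \notin C & x |: C \in F}].

Definition ex F A : {set U} := [set x in A | x \notin clos F (A :\ x)].

Definition quasi_closed F Q : bool :=
  (Q \notin F) &&
  [forall A : {set U},
     (A \subset Q) ==> (clos F A \proper clos F Q) ==> (clos F A \subset Q)].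

Definition quasi_closed_of F C Q : bool := quasi_closed F Q && (clos F Q == C).

Definition essential F C : bool :=
  (C \in F) && [exists Q : {set U}, quasi_closed_of F C Q].

(* Edge set of the quasi-closed hypergraph on the vertex set C. *)
Definition qc_edges F C : {set {set U}} :=
  [set C :\: Q | Q : {set U} & maxset (quasi_closed_of F C) Q].

End ClosureSystems.

Section Implications.
Variable U : finType.

(* (A, B) stands for the implication A -> B. *)
Definition implication : Type := {set U} * {set U}.

Definition satisfies (X : {set U}) (i : implication) : bool :=
  (i.1 \subset X) ==> (i.2 \subset X).

Definition is_base (F : {set {set U}}) (S : seq implication) : Prop :=
  F = [set X : {set U} | all (satisfies X) S].

Definition total_size (S : seq implication) : nat :=
  \sum_(i <- S) (#|i.1| + #|i.2|).

Definition optimum_base (F : {set {set U}}) (S : seq implication) : Prop :=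
  is_base F S /\ forall S', is_base F S' -> total_size S <= total_size S'.

Definition implication_graph (S : seq implication) : rel U :=
  fun a b => has (fun i : implication => (a \in i.1) && (b \in i.2)) S.

End Implications.

Section Classes.
Variable U : finType.
Implicit Type F : {set {set U}}.

Definition poset_convex (le : rel U) (C : {set U}) : bool :=
  [forall x in C, forall y in C, (le x y && (x != y)) ==>
     ([set z | le x z && le z y] \subset C)].

Definition double_shelling F : Prop :=
  exists le : rel U, [/\ reflexive le, antisymmetric le, transitive le &
    F = [set C : {set U} | poset_convex le C]].

Definition acyclic F : Prop :=
  exists S : seq (implication U),
    [/\ is_base F S,
        all (fun i : implication U => [disjoint i.1 & i.2]) S &
        forall c : seq U, c != [::] -> ~~ cycle (implication_graph S) c].

(* v lies in the convex hull of the finite point set pt @: Y. *)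
Definition in_conv (R : realType) (d : nat) (pt : U -> 'rV[R]_d)
    (Y : {set U}) (v : 'rV[R]_d) : Prop :=
  exists w : U -> R, [/\ forall y, (0 <= w y)%R,
    (\sum_(y in Y) w y = 1)%R & (v = \sum_(y in Y) w y *: pt y)%R].

(* U is identified, through the injection pt, with a finite set of points. *)
Definition affine (R : realType) F : Prop :=
  exists (d : nat) (pt : U -> 'rV[R]_d), injective pt /\
    forall (Y : {set U}) (x : U), x \in clos F Y <-> in_conv pt Y (pt x).

Definition q_acceptant (q : nat) F : Prop :=
  {in F, forall C : {set U}, #|ex F C| = minn q #|C|}.

Definition acceptant F : Prop :=
  exists q : nat, 1 <= q <= #|U| /\ q_acceptant q F.

End Classes.

(** Model of computation: Jones's language WHILE (N. D. Jones, Computability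
    and Complexity from a Programming Perspective, 1997), imperative programs
    over binary trees, with its standard running time: every elementary tree
    operation, assignment and test costs one unit.  There is no unit-cost
    equality test, so each step is a constant number of pointer operations and
    polynomial time agrees with polynomial time on Turing machines.  Values may
    share subtrees, hence the size of the written-out output is bounded
    separately in [optimizable_in_poly_time]. *)

Inductive tree : Type := Nil | Cons of tree & tree.

Fixpoint tree_size (t : tree) : nat :=
  if t is Cons a b then (tree_size a + tree_size b).+1 else 1.

Definition store : Type := nat -> tree.

Definition update (s : store) (x : nat) (v : tree) : store :=
  fun y => if y == x then v else s y.

Inductive expr : Type :=
| EVar of nat
| ENil
| ECons of expr & expr
| EHd of expr
| ETl of expr.

Fixpoint eval (s : store) (e : expr) : tree :=
  match e with
  | EVar x => s x
  | ENil => Nil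
  | ECons e1 e2 => Cons (eval s e1) (eval s e2)
  | EHd e1 => if eval s e1 is Cons a _ then a else Nil
  | ETl e1 => if eval s e1 is Cons _ b then b else Nil
  end.

Fixpoint expr_cost (e : expr) : nat :=
  match e with
  | EVar _ | ENil => 1
  | ECons e1 e2 => (expr_cost e1 + expr_cost e2).+1
  | EHd e1 | ETl e1 => (expr_cost e1).+1
  end.

Inductive cmd : Type :=
| CAssign of nat & expr
| CSeq of cmd & cmd
| CIf of expr & cmd & cmd
| CWhile of expr & cmd.

(* exec c s t s' : started in s, c terminates in s' after time t; Nil is the
   truth value false, any other tree is true. *)
Inductive exec : cmd -> store -> nat -> store -> Prop :=
| ExecAssign x e s :
    exec (CAssign x e) s (expr_cost e).+1 (update s x (eval s e))
| ExecSeq c1 c2 s s1 s2 t1 t2 :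
    exec c1 s t1 s1 -> exec c2 s1 t2 s2 ->
    exec (CSeq c1 c2) s (t1 + t2).+1 s2
| ExecIfTrue e c1 c2 s s1 t :
    eval s e <> Nil -> exec c1 s t s1 ->
    exec (CIf e c1 c2) s (expr_cost e + t).+1 s1
| ExecIfFalse e c1 c2 s s1 t :
    eval s e = Nil -> exec c2 s t s1 ->
    exec (CIf e c1 c2) s (expr_cost e + t).+1 s1
| ExecWhileTrue e c s s1 s2 t1 t2 :
    eval s e <> Nil -> exec c s t1 s1 -> exec (CWhile e c) s1 t2 s2 ->
    exec (CWhile e c) s (expr_cost e + t1 + t2).+1 s2
| ExecWhileFalse e c s :
    eval s e = Nil -> exec (CWhile e c) s (expr_cost e).+1 s.

(* Input and output are in variable 0; all other variables start as Nil. *)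
Definition computes (c : cmd) (inp out : tree) (t : nat) : Prop :=
  exists s : store, exec c (update (fun=> Nil) 0 inp) t s /\ s 0 = out.

Definition enc_list (T : Type) (enc : T -> tree) (s : seq T) : tree :=
  foldr (fun x t => Cons (enc x) t) Nil s.

Definition enc_bool (b : bool) : tree := if b then Cons Nil Nil else Nil.

Definition enc_nat (n : nat) : tree := enc_list (fun=> Nil) (nseq n tt).

Section Encoding.
Variable U : finType.

(* Characteristic bit vector along the enumeration of U. *)
Definition enc_set (A : {set U}) : tree :=
  enc_list enc_bool [seq x \in A | x <- enum U].

Definition enc_implication (i : implication U) : tree :=
  Cons (enc_set i.1) (enc_set i.2).

(* The cardinality of U is given in unary, so that the size of the input is
   polynomially related to |U| + |S| + total_size S. *)
Definition enc_base (S : seq (implication U)) : tree :=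
  Cons (enc_nat #|U|) (enc_list enc_implication S).

End Encoding.

(* A single program, with a single polynomial bound, turns any implicational
   base of any closure system in the class K into an optimum one. *)
Definition optimizable_in_poly_time
    (K : forall U : finType, {set {set U}} -> Prop) : Prop :=
  exists (c : cmd) (p : {poly nat}),
    forall (U : finType) (F : {set {set U}}) (S : seq (implication U)),
      K U F -> is_base F S ->
      exists (S' : seq (implication U)) (t : nat),
        [/\ optimum_base F S',
            computes c (enc_base S) (enc_base S') t,
            t <= p.[tree_size (enc_base S)]%R &
            tree_size (enc_base S') <= p.[tree_size (enc_base S)]%R].

Definition listed_convex_geometry (R : realType) (U : finType)
    (F : {set {set U}}) : Prop :=
  convex_geometry F /\
  [\/ double_shelling F, acyclic F, affine R F | acceptant F].

(* Main.v *)
Require Import Defs.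
From mathcomp Require Import all_boot all_order all_algebra reals.
From mathcomp Require Import zify.

Set Implicit Arguments.
Unset Strict Implicit.
Unset Printing Implicit Defensive.

(** In a convex geometry a set [Q] is quasi-closed with closure [C] iff
    [ex F C \subset Q \proper C] and [Q :\ e] is closed for every [e] in
    [ex F C].  From this: in an affine geometry [ex F C] is the only such [Q];
    in an acceptant one they form a chain; in a double-shelling one they are
    stable under unions different from [C]; in an acyclic one the maximal ones
    are the sets [C :\ x].

    Since every generating set of [C] contains [ex F C], a base must contain,
    for each essential [C], premises at least as large as [ex F C] and
    conclusions that together meet every edge of the quasi-closed hypergraph.
    When the edges are disjoint, an inclusion-minimal transversal has minimum
    size, so it is optimal to shrink greedily first the premises, and then,
    after closing the conclusions, the conclusions.

    For the running time, functions on trees computed by WHILE programs in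
    polynomial time are closed under composition, pairing, branching and
    iteration over a list, as long as the accumulator grows additively. *)

(* seq.v has its own [Nil] and [Cons]. *)
Local Notation Nil := Defs.Nil.
Local Notation Cons := Defs.Cons.

(** * Polynomial-time functions on trees *)

(** The base [n.+2] is at least 2 even for [n = 0], so raising the exponent absorbs constants, sums
    and products. *)
Definition bd (k n : nat) : nat := n.+2 ^ k.

Definition poly_bounded (b : nat -> nat) : Prop :=
  exists k, forall n, b n <= bd k n.

Lemma bd_gt0 k n : 0 < bd k n.
Proof. by rewrite expn_gt0. Qed.

Lemma leq_bd k l m n : k <= l -> m <= n -> bd k m <= bd l n.
Proof.
move=> le_kl le_mn; apply: (@leq_trans (bd l m)); first by rewrite leq_pexp2l.
by case: l le_kl => [|l] _ //; rewrite leq_exp2r.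
Qed.

Lemma poly_bounded_const c : poly_bounded (fun=> c).
Proof. by exists c => n; apply/ltnW/ltn_expl. Qed.

Lemma poly_bounded_id : poly_bounded id.
Proof. by exists 1 => n; rewrite /bd expn1; lia. Qed.

Lemma poly_boundedD b1 b2 :
  poly_bounded b1 -> poly_bounded b2 -> poly_bounded (fun n => b1 n + b2 n).
Proof.
move=> [k1 h1] [k2 h2]; exists (k1 + k2).+1 => n.
have le1 : bd k1 n <= bd (k1 + k2) n by apply: leq_bd; lia.
have le2 : bd k2 n <= bd (k1 + k2) n by apply: leq_bd; lia.
have -> : bd (k1 + k2).+1 n = n.+2 * bd (k1 + k2) n by rewrite /bd expnS.
have := h1 n; have := h2 n; nia.
Qed.

Lemma poly_boundedM b1 b2 :
  poly_bounded b1 -> poly_bounded b2 -> poly_bounded (fun n => b1 n * b2 n).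
Proof.
move=> [k1 h1] [k2 h2]; exists (k1 + k2) => n.
by rewrite /bd expnD leq_mul // ?h1 ?h2.
Qed.

Lemma poly_bounded_bd k b : poly_bounded b -> poly_bounded (fun n => bd k (b n)).
Proof.
(* Two extra factors [n.+2] pay for the shift inside the outer [bd]:
   [bd l n + 2 <= bd l n * n.+2 ^ 2]. *)
move=> [l hl]; exists ((l + 2) * k) => n.
apply: (@leq_trans (bd k (bd l n))); first exact: leq_bd.
rewrite /bd expnM; case: k => [|k] //; rewrite leq_exp2r // expnD.
have := bd_gt0 l n; rewrite /bd; nia.
Qed.

Lemma poly_boundedS b : poly_bounded b -> poly_bounded (fun n => (b n).+1).
Proof.
move=> hb; case: (poly_boundedD hb (poly_bounded_const 1)) => k hk.
by exists k => n; rewrite -addn1.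
Qed.

Ltac poly_bound := repeat first
  [ apply: poly_bounded_const | apply: poly_bounded_id | assumption
  | apply: poly_boundedD | apply: poly_boundedM
  | apply: poly_boundedS | apply: poly_bounded_bd ].

(** * Total-correctness rules with time bounds for WHILE programs *)

Definition runs (c : cmd) (s : store) (T : nat) (P : store -> Prop) : Prop :=
  exists t s', [/\ exec c s t s', t <= T & P s'].

Lemma runs_weaken c s T T' (P P' : store -> Prop) :
  T <= T' -> (forall s', P s' -> P' s') -> runs c s T P -> runs c s T' P'.
Proof.
move=> leT PP' [t [s' [? ? ?]]]; exists t, s'; split=> //; last exact: PP'.
exact: leq_trans leT.
Qed.

Lemma runs_le c s T T' (P : store -> Prop) :
  T <= T' -> runs c s T P -> runs c s T' P.
Proof. by move=> leT; apply: runs_weaken. Qed.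

Lemma runs_assign x e s T (P : store -> Prop) :
  expr_cost e < T -> P (update s x (eval s e)) -> runs (CAssign x e) s T P.
Proof.
by move=> ? ?; exists (expr_cost e).+1; eexists; split; [exact: ExecAssign| |].
Qed.

Lemma runs_seq c1 c2 s T1 T2 (P Q : store -> Prop) :
    runs c1 s T1 P -> (forall s1, P s1 -> runs c2 s1 T2 Q) ->
  runs (CSeq c1 c2) s (T1 + T2).+1 Q.
Proof.
move=> [t1 [s1 [? ? /[swap] /[apply]]]] [t2 [s2 [? ? ?]]].
by exists (t1 + t2).+1, s2; split=> //; [apply: ExecSeq; eassumption|lia].
Qed.

Lemma runs_assign_seq x e c s T (Q : store -> Prop) :
    runs c (update s x (eval s e)) T Q ->
  runs (CSeq (CAssign x e) c) s ((expr_cost e).+1 + T).+1 Q.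
Proof.
move=> h; apply: (@runs_seq _ _ _ _ _ (eq (update s x (eval s e)))).
  exact: runs_assign.
by move=> _ <-.
Qed.

Lemma runs_if e c1 c2 s T (P : store -> Prop) :
    (eval s e <> Nil -> runs c1 s T P) -> (eval s e = Nil -> runs c2 s T P) ->
  runs (CIf e c1 c2) s (expr_cost e + T).+1 P.
Proof.
case E: (eval s e) => [|a b] h1 h2.
  have [//|t [s' [? ? ?]]] := h2.
  by exists (expr_cost e + t).+1, s'; split=> //; [apply: ExecIfFalse|lia].
have [//|t [s' [? ? ?]]] := h1.
by exists (expr_cost e + t).+1, s'; split=> //; [apply: ExecIfTrue; rewrite ?E|lia].
Qed.

Lemma runs_while_true e c s T1 T2 (P Q : store -> Prop) :
    eval s e <> Nil -> runs c s T1 P ->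
    (forall s1, P s1 -> runs (CWhile e c) s1 T2 Q) ->
  runs (CWhile e c) s (expr_cost e + T1 + T2).+1 Q.
Proof.
move=> ? [t1 [s1 [? ? /[swap] /[apply]]]] [t2 [s2 [? ? ?]]].
exists (expr_cost e + t1 + t2).+1, s2; split=> //; last lia.
by apply: ExecWhileTrue; eassumption.
Qed.

Lemma runs_while_false e c s T (Q : store -> Prop) :
  eval s e = Nil -> expr_cost e < T -> Q s -> runs (CWhile e c) s T Q.
Proof.
by move=> ? ? ?; exists (expr_cost e).+1, s; split=> //; apply: ExecWhileFalse.
Qed.

(* The frame condition lets a caller keep values in the variables above [m];
   no assumption is made on the initial contents of the variables other than 0.
   The size of the result has to be bounded separately from the time, since
   trees share subtrees. *)
Definition computes_in (c : cmd) (m k : nat) (f : tree -> tree) : Prop :=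
  forall s : store,
    runs c s (bd k (tree_size (s 0)))
      (fun s' => s' 0 = f (s 0) /\ forall y, m < y -> s' y = s y) /\
    tree_size (f (s 0)) <= bd k (tree_size (s 0)).

Definition polytime (f : tree -> tree) : Prop :=
  exists c m k, computes_in c m k f.

(** * Closure properties of polynomial-time tree functions *)

Lemma polytime_intro c m b f :
    poly_bounded b ->
    (forall s : store, runs c s (b (tree_size (s 0)))
      (fun s' => s' 0 = f (s 0) /\ forall y, m < y -> s' y = s y)) ->
    (forall t, tree_size (f t) <= b (tree_size t)) ->
  polytime f.
Proof.
move=> [k hk] hc hf; exists c, m, k => s; split; last exact: leq_trans (hk _).
by apply: runs_weaken (hc s) => //; apply: hk.
Qed.

Lemma polytime_size f : polytime f ->
  exists k, forall t, tree_size (f t) <= bd k (tree_size t).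
Proof. by move=> [c [m [k h]]]; exists k => t; have [] := h (fun=> t). Qed.

Lemma polytime_comp f g : polytime f -> polytime g -> polytime (fun t => g (f t)).
Proof.
move=> [cf [mf [kf hf]]] [cg [mg [kg hg]]].
apply: (@polytime_intro (CSeq cf cg) (maxn mf mg)
  (fun n => (bd kf n + bd kg (bd kf n)).+1)); first by poly_bound.
- move=> s; have [rf sf] := hf s; apply: runs_seq rf _ => s1 [e1 fr1].
  have [rg _] := hg s1; apply: runs_weaken rg; first by apply: leq_bd; rewrite // e1.
  move=> s2 [e2 fr2]; split; first by rewrite e2 e1.
  by move=> y hy; rewrite fr2 ?fr1 //; lia.
- move=> t; have [_ /= sf] := hf (fun=> t); have [_ /= sg] := hg (fun=> f t).
  by apply: leq_trans sg _; have := leq_bd (leqnn kg) sf; lia.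
Qed.

Definition thd (t : tree) : tree := if t is Cons a _ then a else Nil.
Definition ttl (t : tree) : tree := if t is Cons _ b then b else Nil.
Definition tif (t u v : tree) : tree := if t is Cons _ _ then u else v.

Lemma tree_size_gt0 t : 0 < tree_size t. Proof. by case: t. Qed.

Lemma thd_size t : tree_size (thd t) <= tree_size t.
Proof. by case: t => //= a b; lia. Qed.

Lemma ttl_size t : tree_size (ttl t) <= tree_size t.
Proof. by case: t => //= a b; lia. Qed.

Lemma polytime_expr e b (f : tree -> tree) :
    (forall s, eval s e = f (s 0)) -> poly_bounded b ->
    (forall t, tree_size (f t) <= b (tree_size t)) -> polytime f.
Proof.
move=> ef hb sf; apply: (@polytime_intro (CAssign 0 e) 0
  (fun n => b n + (expr_cost e).+1)); first by poly_bound.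
- move=> s; apply: runs_assign; first lia.
  by split=> [|y]; rewrite /update ?ef //; case: y.
- by move=> t; apply: leq_trans (sf t) _; lia.
Qed.

Lemma polytime_id : polytime id.
Proof. exact: (@polytime_expr (EVar 0) id id _ poly_bounded_id). Qed.

Lemma polytime_nil : polytime (fun=> Nil).
Proof. exact: (@polytime_expr ENil (fun=> 1) _ _ (poly_bounded_const 1)). Qed.

Lemma polytime_thd f : polytime f -> polytime (fun t => thd (f t)).
Proof.
move=> pf; apply: (polytime_comp pf).
exact: (@polytime_expr (EHd (EVar 0)) id _ _ poly_bounded_id thd_size).
Qed.

Lemma polytime_ttl f : polytime f -> polytime (fun t => ttl (f t)).
Proof.
move=> pf; apply: (polytime_comp pf).
exact: (@polytime_expr (ETl (EVar 0)) id _ _ poly_bounded_id ttl_size).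
Qed.

(** The variables [m] and [m.+1] lie above the frames of both programs: the input saved in [m]
    survives [cf], and the first result saved in [m.+1] survives [cg]. *)
Lemma polytime_cons f g :
  polytime f -> polytime g -> polytime (fun t => Cons (f t) (g t)).
Proof.
move=> [cf [mf [kf hf]]] [cg [mg [kg hg]]].
have [m [hmf hmg]] : exists m, mf < m /\ mg < m.
  by exists (maxn mf mg).+1; lia.
have m_gt0 : (0 == m) = false by lia.
apply: (@polytime_intro
  (CSeq (CAssign m (EVar 0)) (CSeq cf (CSeq (CAssign m.+1 (EVar 0))
    (CSeq (CAssign 0 (EVar m)) (CSeq cg
       (CAssign 0 (ECons (EVar m.+1) (EVar 0))))))))
  m.+1 (fun n => bd kf n + bd kg n + 20)); first by poly_bound.
- move=> s; set t := s 0.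
  have [rf _] := hf (update s m (eval s (EVar 0))).
  apply: runs_le (runs_assign_seq (runs_seq rf _)); last first.
  + move=> s1 [e1 fr1]; apply: runs_assign_seq; apply: runs_assign_seq.
    set s2 := update _ 0 _.
    have s20 : s2 0 = t.
      rewrite /s2 /update /=; have -> : (m == m.+1) = false by lia.
      by rewrite fr1 // /update eqxx.
    have s2m : s2 m.+1 = f t.
      by rewrite /s2 /update /= eqxx e1 /update m_gt0.
    have [rg _] := hg s2; rewrite s20 in rg.
    apply: runs_seq rg _ => s3 [e3 fr3]; apply: (@runs_assign _ _ _ 4) => //.
    split; first by rewrite /update /= e3 fr3 ?s2m //; lia.
    move=> y hy; have y0 : (y == 0) = false by lia.
    have ym : (y == m) = false by lia.
    have ym1 : (y == m.+1) = false by lia.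
    rewrite {1}/update y0 fr3; last lia.
    rewrite /s2 /update y0 ym1 fr1; last lia.
    by rewrite /update ym.
  + have -> : update s m (eval s (EVar 0)) 0 = t by rewrite /update m_gt0.
    by rewrite /=; lia.
- move=> t; have [_ /= sf] := hf (fun=> t); have [_ /= sg] := hg (fun=> t).
  by rewrite /=; lia.
Qed.

(** The condition comes paired with the argument, so that it can be computed beforehand by another
    program; [polytime_tif] supplies this pair. *)
Lemma polytime_branch f g : polytime f -> polytime g ->
  polytime (fun t => tif (thd t) (f (ttl t)) (g (ttl t))).
Proof.
move=> [cf [mf [kf hf]]] [cg [mg [kg hg]]].
have [m [hmf hmg]] : exists m, mf < m /\ mg < m.
  by exists (maxn mf mg).+1; lia.
have m_gt0 : (0 == m) = false by lia.
apply: (@polytime_intro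
  (CSeq (CAssign m (EHd (EVar 0))) (CSeq (CAssign 0 (ETl (EVar 0)))
     (CIf (EVar m) cf cg)))
  m (fun n => bd kf n + bd kg n + 20)); first by poly_bound.
- move=> s; set t := s 0.
  set s1 := update s m (eval s (EHd (EVar 0))).
  set s2 := update s1 0 (eval s1 (ETl (EVar 0))).
  have s20 : s2 0 = ttl t by rewrite /s2 /s1 /update /= m_gt0.
  have s2m : eval s2 (EVar m) = thd t.
    have m0 : (m == 0) = false by lia.
    by rewrite /= /s2 /s1 /update /= m0 eqxx.
  have fr2 y : m < y -> s2 y = s y.
    move=> hy; have y0 : (y == 0) = false by lia.
    have ym : (y == m) = false by lia.
    by rewrite /s2 /s1 /update y0 ym.
  have le1 := leq_bd (leqnn kf) (ttl_size t).
  have le2 := leq_bd (leqnn kg) (ttl_size t).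
  apply: runs_le (runs_assign_seq (runs_assign_seq
    (@runs_if _ _ _ _ (bd kf (tree_size t) + bd kg (tree_size t)) _ _ _)));
    first by rewrite /=; lia.
  + rewrite -/s1 -/s2 /= => E.
    have {E} -> : tif (thd t) (f (ttl t)) (g (ttl t)) = f (ttl t).
      by move: E; rewrite -/(eval s2 (EVar m)) s2m; case: (thd t).
    have [rf _] := hf s2; apply: runs_weaken rf; rewrite s20; first lia.
    move=> s3 [-> fr3]; split=> // y hy; rewrite fr3 ?fr2 //; lia.
  + rewrite -/s1 -/s2 /= => E.
    have {E} -> : tif (thd t) (f (ttl t)) (g (ttl t)) = g (ttl t).
      by move: E; rewrite -/(eval s2 (EVar m)) s2m; case: (thd t).
    have [rg _] := hg s2; apply: runs_weaken rg; rewrite s20; first lia.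
    move=> s3 [-> fr3]; split=> // y hy; rewrite fr3 ?fr2 //; lia.
- move=> t; have [_ /= sf] := hf (fun=> ttl t); have [_ /= sg] := hg (fun=> ttl t).
  have le1 := leq_bd (leqnn kf) (ttl_size t).
  have le2 := leq_bd (leqnn kg) (ttl_size t).
  by case: (thd t) => * /=; lia.
Qed.

Lemma polytime_tif b f g : polytime b -> polytime f -> polytime g ->
  polytime (fun t => tif (b t) (f t) (g t)).
Proof.
move=> pb pf pg.
exact: (polytime_comp (polytime_cons pb polytime_id) (polytime_branch pf pg)).
Qed.

Fixpoint tfoldl (h : tree -> tree -> tree) (l a : tree) : tree :=
  if l is Cons e l' then tfoldl h l' (h e a) else a.

Lemma tfoldl_size h l a W :
    (forall e acc, tree_size e < tree_size l ->
       tree_size (h e acc) <= tree_size acc + W) ->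
  tree_size (tfoldl h l a) <= tree_size a + tree_size l * W.
Proof.
elim: l a => [|e _ l IHl] a hW /=; first lia.
apply: leq_trans (IHl _ _) _; first by move=> e' acc he; apply: hW => /=; lia.
have := hW e a; rewrite /= => /(_ _) H; have := H ltac:(lia); nia.
Qed.

(* The accumulator grows additively, so that the iterates stay of polynomial
   size. *)
Definition additive (h : tree -> tree -> tree -> tree) : Prop :=
  exists k, forall x e acc,
    tree_size (h x e acc) <= tree_size acc + bd k (tree_size x + tree_size e).

(** A single loop keeps the parameter, the remaining list and the accumulator in [m], [m.+1] and
    [m.+2], above the frame of the program for [h]. *)
Lemma polytime_foldl_input (h : tree -> tree -> tree -> tree) :
    additive h -> polytime (fun t => h (thd t) (thd (ttl t)) (ttl (ttl t))) ->
  polytime (fun t => tfoldl (h (thd t)) (thd (ttl t)) (ttl (ttl t))).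
Proof.
move=> [ka ha] [c [m0 [k hc]]]; have [m m0m] : exists m, m0 < m by exists m0.+1.
have m_gt0 : (m == 0) = false by lia.
pose body := CSeq
  (CAssign 0 (ECons (EVar m) (ECons (EHd (EVar m.+1)) (EVar m.+2))))
  (CSeq c (CSeq (CAssign m.+2 (EVar 0)) (CAssign m.+1 (ETl (EVar m.+1))))).
(* The inequality on [M] reserves room for the growth in all remaining rounds, so one [M] bounds
   every accumulator and all rounds get the same time bound. *)
have loop x N M : forall l a s, s m = x -> s m.+1 = l -> s m.+2 = a ->
    tree_size l <= N ->
    tree_size a + tree_size l * bd ka (tree_size x + N) <= M ->
    runs (CWhile (EVar m.+1) body) s
      (tree_size l * (bd k (tree_size x + N + M).+2 + 20))
      (fun s' => s' m.+2 = tfoldl (h x) l a /\ forall y, m.+2 < y -> s' y = s y).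
  elim=> [|e _ l IHl] a s sx sl sa leN leM.
    by apply: runs_while_false => //=; lia.
  pose s1 := update s 0 (Cons x (Cons e a)).
  have es1 : update s 0 (eval s
      (ECons (EVar m) (ECons (EHd (EVar m.+1)) (EVar m.+2)))) = s1.
    by rewrite /s1 /= sx sl sa.
  have [rc _] := hc s1.
  have s10 : s1 0 = Cons x (Cons e a) by [].
  rewrite s10 /= in rc.
  pose a' := h x e a.
  have sa' : tree_size a' <= tree_size a + bd ka (tree_size x + N).
    apply: leq_trans (ha x e a) _; rewrite leq_add2l; apply: leq_bd => //.
    by move: leN => /=; lia.
  pose T := bd k (tree_size x + N + M).+2.
  have leT : bd k (tree_size x + (tree_size e + tree_size a).+1).+1 <= T.
    by apply: leq_bd => //; move: leN leM => /=; lia.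
  apply: (@runs_le _ _ (1 + (T + 18) + tree_size l * (T + 20)).+1).
    by rewrite /= -/T; lia.
  apply: (@runs_while_true _ _ _ (T + 18) (tree_size l * (T + 20))
      (fun s' => [/\ s' m = x, s' m.+1 = l, s' m.+2 = a' &
                    forall y, m.+2 < y -> s' y = s y])).
  - by rewrite /= sl.
  - rewrite /body; apply: runs_le (runs_assign_seq _); last first.
      rewrite es1; apply: runs_seq rc _ => s2 [e2 fr2].
      apply: runs_assign_seq; apply: (@runs_assign _ _ _ 3) => //.
      have [n1 n2] : (m == m.+1) = false /\ (m == m.+2) = false by lia.
      have [n3 n4] : (m.+1 == m.+2) = false /\ (m.+2 == m.+1) = false by lia.
      split; rewrite /update /= ?eqxx ?n1 ?n2 ?n3 ?n4 //.
      + by rewrite fr2 ?/s1 ?/update ?m_gt0.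
      + by rewrite fr2 ?/s1 ?/update //= ?sl //; lia.
      + move=> y hy.
        have [-> ->] : (y == m.+1) = false /\ (y == m.+2) = false by lia.
        rewrite fr2; last lia.
        by rewrite /s1 /update; have -> : (y == 0) = false by lia.
    by move: leT => /=; lia.
  - move=> s1' [h1 h2 h3 h4].
    apply: runs_weaken (IHl a' s1' h1 h2 h3 _ _) => //.
    + move=> s' [e1 fr1]; split=> // y hy; rewrite fr1 ?h4 //; lia.
    + by move: leN => /=; lia.
    + by move: leM sa' => /=; nia.
apply: (@polytime_intro
  (CSeq (CAssign m (EHd (EVar 0))) (CSeq (CAssign m.+1 (EHd (ETl (EVar 0))))
     (CSeq (CAssign m.+2 (ETl (ETl (EVar 0))))
     (CSeq (CWhile (EVar m.+1) body) (CAssign 0 (EVar m.+2))))))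
  m.+2 (fun n => n * (bd k (n + n + (n + n * bd ka (n + n))).+2 + 20)
                 + (n + n * bd ka (n + n)) + 50)); first by poly_bound.
- move=> s; set t := s 0.
  have lex := thd_size t.
  have lel : tree_size (thd (ttl t)) <= tree_size t.
    exact: leq_trans (thd_size _) (ttl_size _).
  have lea : tree_size (ttl (ttl t)) <= tree_size t.
    exact: leq_trans (ttl_size _) (ttl_size _).
  have [n1 n2] : (m == m.+1) = false /\ (m == m.+2) = false by lia.
  have [n3 n4] : (m.+1 == m.+2) = false /\ (m.+2 == m.+1) = false by lia.
  pose n := tree_size t.
  set s1 := update (update (update s m (thd t)) m.+1 (thd (ttl t))) m.+2
    (ttl (ttl t)).
  have lW : tree_size (ttl (ttl t)) +
      tree_size (thd (ttl t)) * bd ka (tree_size (thd t) + n) <=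
      n + n * bd ka (n + n).
    have := @leq_bd ka ka (tree_size (thd t) + n) (n + n) (leqnn _).
    by rewrite -/n in lex lel lea *; move=> /(_ ltac:(lia)); nia.
  have run := loop (thd t) n (n + n * bd ka (n + n)) (thd (ttl t)) (ttl (ttl t)) s1.
  have [] : [/\ s1 m = thd t, s1 m.+1 = thd (ttl t) & s1 m.+2 = ttl (ttl t)].
    by rewrite /s1 /update !eqxx n1 n2 n3.
  move=> /run{}run /run{}run /run{}run; have {}run := run lel lW.
  have up0 v : update s m v 0 = t by rewrite /update eq_sym m_gt0.
  have up1 v w : update (update s m v) m.+1 w 0 = t.
    by rewrite /update eq_sym /= eq_sym m_gt0.
  eapply runs_le; last first.
    apply: runs_assign_seq; apply: runs_assign_seq; apply: runs_assign_seq.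
    rewrite /= up0 up1 -/t -/s1; apply: (runs_seq run) => s2 [e2 fr2].
    apply: (@runs_assign _ _ _ 3) => //.
    split=> [|y hy]; rewrite /update /= ?e2 //.
    have -> : (y == 0) = false by lia.
    rewrite fr2 // /s1 /update.
    have -> : (y == m) = false by lia.
    by have [-> ->] : (y == m.+1) = false /\ (y == m.+2) = false by lia.
  have := @leq_bd k k (tree_size (thd t) + n + (n + n * bd ka (n + n))).+2
    (n + n + (n + n * bd ka (n + n))).+2 (leqnn _).
  rewrite -/n in lex lel lea *; rewrite /= => /(_ ltac:(lia)).
  have := leq_mul lel; nia.
- move=> t; set n := tree_size t.
  have lex : tree_size (thd t) <= n by exact: thd_size.
  have lel : tree_size (thd (ttl t)) <= n.
    exact: leq_trans (thd_size _) (ttl_size _).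
  have lea : tree_size (ttl (ttl t)) <= n.
    exact: leq_trans (ttl_size _) (ttl_size _).
  have hW e acc : tree_size e < tree_size (thd (ttl t)) ->
      tree_size (h (thd t) e acc) <= tree_size acc + bd ka (n + n).
    move=> he; apply: leq_trans (ha _ _ _) _; rewrite leq_add2l.
    by apply: leq_bd => //; lia.
  have := @tfoldl_size _ _ (ttl (ttl t)) _ hW.
  by nia.
Qed.

Lemma polytime_foldl h x l a :
    additive h -> polytime (fun t => h (thd t) (thd (ttl t)) (ttl (ttl t))) ->
    polytime x -> polytime l -> polytime a ->
  polytime (fun t => tfoldl (h (x t)) (l t) (a t)).
Proof.
move=> ah ph px pl pa.
exact: (polytime_comp (polytime_cons px (polytime_cons pl pa))
                      (polytime_foldl_input ah ph)).
Qed.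

(** * The optimization program *)

(** Step functions take the fixed parameter of [polytime_foldl] before the list entry and the
    accumulator, so that every loop of the program is an instance of that lemma. *)
Definition cat_step (_ e acc : tree) : tree := Cons e acc.
Definition tcatrev (l a : tree) : tree := tfoldl (cat_step Nil) l a.

(* The accumulator is the pair of the unread part of the second bit vector and
   the answer so far. *)
Definition subset_step (_ e acc : tree) : tree :=
  Cons (ttl (thd acc)) (tif e (tif (thd (thd acc)) (ttl acc) Nil) (ttl acc)).
Definition tsubset (A X : tree) : tree :=
  ttl (tfoldl (subset_step Nil) A (Cons X (Cons Nil Nil))).

(** The accumulator pairs the unread bits of [B] with the bits of the union so far, in reverse
    order; [tunion] reverses them at the end. *)
Definition union_step (_ e acc : tree) : tree :=
  Cons (ttl (thd acc)) (Cons (tif e e (thd (thd acc))) (ttl acc)).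
Definition tunion (X B : tree) : tree :=
  tcatrev (ttl (tfoldl (union_step Nil) X (Cons B Nil))) Nil.

Definition pass_step (_ e acc : tree) : tree :=
  tif (tsubset (thd e) acc) (tunion acc (ttl e)) acc.
Definition tpass (L X : tree) : tree := tfoldl (pass_step Nil) L X.

Definition clos_step (L _ acc : tree) : tree := tpass L acc.
(* The bit vector [X] also serves as a counter: |U| passes reach the closure. *)
Definition tclos (L X : tree) : tree := tfoldl (clos_step L) X X.

(* The accumulator is the pair of the reversed processed bits and the bits still
   to be processed. *)
Definition greedy_step (test : tree -> tree -> tree) (env e acc : tree) : tree :=
  Cons (Cons (tif (test env (tcatrev (thd acc) (Cons Nil (ttl (ttl acc))))) Nil e)
             (thd acc))
       (ttl (ttl acc)).
Definition tgreedy (test : tree -> tree -> tree) (env A : tree) : tree :=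
  tcatrev (thd (tfoldl (greedy_step test env) A (Cons Nil A))) Nil.

(** Here [env] pairs the list of implications with the original premise, which the closure of the
    candidate [A] must still contain. *)
Definition premise_test (env A : tree) : tree :=
  tsubset (ttl env) (tclos (thd env) A).
Definition saturate_imp (z : tree) : tree :=
  Cons (tgreedy premise_test (Cons (thd z) (thd (ttl z))) (thd (ttl z)))
       (tclos (thd z) (thd (ttl z))).
Definition saturate_step (L e acc : tree) : tree :=
  Cons (saturate_imp (Cons L e)) acc.

(** Here [env] pairs the implication being shortened with the list of all the others; the candidate
    [B] must still let its premise derive its whole conclusion. *)
Definition conclusion_test (env B : tree) : tree :=
  tsubset (ttl (thd env))
          (tclos (Cons (Cons (thd (thd env)) B) (ttl env)) (thd (thd env))).
(** The accumulator pairs the processed implications with the unread ones, headed by [e]; hence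
    [tcatrev (thd acc) (ttl (ttl acc))] lists all implications other than [e]. *)
Definition prune_step (_ e acc : tree) : tree :=
  tif (tsubset (ttl e) (tclos (tcatrev (thd acc) (ttl (ttl acc))) (thd e)))
      (Cons (thd acc) (ttl (ttl acc)))
      (Cons (Cons (Cons (thd e)
                        (tgreedy conclusion_test
                           (Cons e (tcatrev (thd acc) (ttl (ttl acc)))) (ttl e)))
                  (thd acc))
            (ttl (ttl acc))).

Definition tprune (S : tree) : tree :=
  thd (tfoldl (prune_step Nil) S (Cons Nil S)).
Definition toptimize (inp : tree) : tree :=
  Cons (thd inp)
       (tprune (tfoldl (saturate_step (ttl inp)) (ttl inp) Nil)).

(* Matching on the syntax keeps unification from unfolding the programs. *)
Ltac polytime_basic := repeat first
  [ assumption
  | lazymatch goal with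
    | |- polytime (fun t => t) => apply: polytime_id
    | |- polytime thd => apply: (polytime_thd polytime_id)
    | |- polytime ttl => apply: (polytime_ttl polytime_id)
    | |- polytime (fun=> Nil) => apply: polytime_nil
    | |- polytime (fun t => thd (@?f t)) => apply: polytime_thd
    | |- polytime (fun t => ttl (@?f t)) => apply: polytime_ttl
    | |- polytime (fun t => Cons (@?f t) (@?g t)) => apply: polytime_cons
    | |- polytime (fun t => tif (@?b t) (@?f t) (@?g t)) => apply: polytime_tif
    end ].

(** * Polynomial running time of the optimization program *)

Lemma additive_linear h c :
    (forall x e acc, tree_size (h x e acc) <=
       tree_size acc + c * (tree_size x + tree_size e)) ->
  additive h.
Proof.
move=> hc; have [k hk] : poly_bounded (fun n => c * n) by poly_bound.
by exists k => x e acc; apply: leq_trans (hc _ _ _) _; rewrite leq_add2l.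
Qed.

Lemma additive_cons f :
  polytime f -> additive (fun x e acc => Cons (f (Cons x e)) acc).
Proof.
move=> /polytime_size[k hk].
have [k' hk'] : poly_bounded (fun n => (bd k n.+1).+1) by poly_bound.
exists k' => x e acc /=; have := hk (Cons x e).
have := hk' (tree_size x + tree_size e); rewrite /=; lia.
Qed.

Lemma polytime_tcatrev f g :
  polytime f -> polytime g -> polytime (fun t => tcatrev (f t) (g t)).
Proof.
move=> pf pg; apply: (polytime_foldl (h := cat_step) (x := fun=> Nil)) => //;
  rewrite /cat_step; polytime_basic.
by apply: (@additive_linear _ 1) => x e acc /=; have := tree_size_gt0 x; lia.
Qed.

Lemma tcatrev_size l a : tree_size (tcatrev l a) <= tree_size l + tree_size a.
Proof.
rewrite /tcatrev; elim: l a => [|e _ l IHl] a /=; first lia.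
by apply: leq_trans (IHl _) _ => /=; lia.
Qed.

Lemma polytime_tsubset f g :
  polytime f -> polytime g -> polytime (fun t => tsubset (f t) (g t)).
Proof.
move=> pf pg; apply: polytime_ttl.
apply: (polytime_foldl (h := subset_step) (x := fun=> Nil));
  rewrite /subset_step; polytime_basic.
apply: (@additive_linear _ 2) => x e [|[|a b] c] /=;
  by have := tree_size_gt0 x; case: e => *; try case: a => *; rewrite /=; lia.
Qed.

Lemma polytime_tunion f g :
  polytime f -> polytime g -> polytime (fun t => tunion (f t) (g t)).
Proof.
move=> pf pg; apply: polytime_tcatrev; polytime_basic.
apply: (polytime_foldl (h := union_step) (x := fun=> Nil));
  rewrite /union_step; polytime_basic.
apply: (@additive_linear _ 3) => x e [|[|a b] c] /=;
  by have := tree_size_gt0 x; case: e => *; rewrite /=; lia.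
Qed.

(** The coefficient 1 of [tree_size X] matters: [X] is the accumulator in [pass_step], which has to
    grow additively. *)
Lemma tunion_size X B : tree_size (tunion X B) <= tree_size X + tree_size B + 3.
Proof.
have h o : tree_size (tfoldl (union_step Nil) X (Cons B o)) <=
    tree_size X + (tree_size B + tree_size o + 1).
  elim: X B o => [|e _ l IHl] B o /=; first lia.
  apply: leq_trans (IHl _ _) _; case: e => [|e1 e2] /=; case: B => [|b1 b2] /=; lia.
apply: leq_trans (tcatrev_size _ _) _ => /=.
have := ttl_size (tfoldl (union_step Nil) X (Cons B Nil)).
by have := h Nil; rewrite /=; lia.
Qed.

Lemma pass_step_size x e acc :
  tree_size (pass_step x e acc) <= tree_size acc + (tree_size e + 3).
Proof.
rewrite /pass_step; have := tunion_size acc (ttl e); have := ttl_size e.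
by case: tsubset => * /=; lia.
Qed.

Lemma polytime_tpass f g :
  polytime f -> polytime g -> polytime (fun t => tpass (f t) (g t)).
Proof.
move=> pf pg; apply: (polytime_foldl (h := pass_step) (x := fun=> Nil)) => //.
- apply: (@additive_linear _ 3) => x e acc.
  by have := pass_step_size x e acc; have := tree_size_gt0 x; lia.
- rewrite /pass_step; apply: polytime_tif; polytime_basic.
    by apply: polytime_tsubset; polytime_basic.
  by apply: polytime_tunion; polytime_basic.
- exact: polytime_nil.
Qed.

Lemma polytime_tclos f g :
  polytime f -> polytime g -> polytime (fun t => tclos (f t) (g t)).
Proof.
move=> pf pg; apply: (polytime_foldl (h := clos_step)) => //; last first.
  by apply: polytime_tpass; polytime_basic.
(* A pass over a list of size [n] makes at most [n] steps, each adding at most [n + 3]. *)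
have [k hk] : poly_bounded (fun n => n * (n + 3)) by poly_bound.
exists k => x e acc; apply: leq_trans (_ : tree_size acc + bd k (tree_size x) <= _).
  apply: leq_trans (tfoldl_size (W := tree_size x + 3) _ _) _.
    by move=> e' acc' h; have := pass_step_size Nil e' acc'; lia.
  by rewrite leq_add2l.
by rewrite leq_add2l; apply: leq_bd; lia.
Qed.

Lemma greedy_step_size test env e acc :
  tree_size (greedy_step test env e acc) <= tree_size acc + (tree_size e + 4).
Proof.
rewrite /greedy_step; case: test => *; case: acc => [|a [|b c]] /=;
  by have := tree_size_gt0 e; lia.
Qed.

(** The bound does not depend on [test] or [env]; this makes [prune_step] additive although its
    environment contains the accumulator. *)
Lemma tgreedy_size :
  exists k, forall test env A, tree_size (tgreedy test env A) <= bd k (tree_size A).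
Proof.
have [k hk] : poly_bounded (fun n => n + 2 + n * (n + 4) + 1) by poly_bound.
exists k => test env A; apply: leq_trans (hk _).
apply: leq_trans (tcatrev_size _ _) _; rewrite leq_add2r.
apply: leq_trans (thd_size _) _.
apply: leq_trans (tfoldl_size (W := tree_size A + 4) _ _) _.
  by move=> e acc h; have := greedy_step_size test env e acc; lia.
by rewrite /=; lia.
Qed.

Lemma polytime_tgreedy test f g :
    polytime (fun t => test (thd t) (ttl t)) -> polytime f -> polytime g ->
  polytime (fun t => tgreedy test (f t) (g t)).
Proof.
move=> pt pf pg; apply: polytime_tcatrev; polytime_basic.
apply: (polytime_foldl (h := greedy_step test)); polytime_basic.
- apply: (@additive_linear _ 4) => x e acc.
  by have := greedy_step_size test x e acc; have := tree_size_gt0 x; lia.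
- rewrite /greedy_step; polytime_basic.
  have pcand : polytime (fun t => Cons (thd t)
      (tcatrev (thd (ttl (ttl t))) (Cons Nil (ttl (ttl (ttl (ttl t))))))).
    by polytime_basic; apply: polytime_tcatrev; polytime_basic.
  exact: polytime_comp pcand pt.
Qed.

Lemma polytime_saturate_imp : polytime saturate_imp.
Proof.
rewrite /saturate_imp; polytime_basic; last by apply: polytime_tclos; polytime_basic.
apply: polytime_tgreedy; polytime_basic.
apply: polytime_tsubset; polytime_basic.
by apply: polytime_tclos; polytime_basic.
Qed.

Lemma polytime_tprune f : polytime f -> polytime (fun t => tprune (f t)).
Proof.
move=> pf; apply: polytime_thd.
apply: (polytime_foldl (h := prune_step) (x := fun=> Nil)); polytime_basic.
- have [k hk] := tgreedy_size.
  have [k' hk'] : poly_bounded (fun n => bd k n + n + 5) by poly_bound.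
  exists k' => x e acc; set a := tree_size acc.
  apply: leq_trans (_ : a + (bd k (tree_size e) + tree_size e + 5) <= _); last first.
    rewrite leq_add2l; apply: leq_trans (hk' _) _; apply: leq_bd => //; lia.
  have hg := hk conclusion_test (Cons e (tcatrev (thd acc) (ttl (ttl acc)))) (ttl e).
  have := leq_bd (leqnn k) (ttl_size e); have := thd_size e.
  have : tree_size (thd acc) + tree_size (ttl (ttl acc)) <= a + 1.
    by rewrite /a; case: (acc) => [|? [|? ?]] /=; lia.
  by rewrite /prune_step; case: tsubset => * /=; lia.
- have pR : polytime (fun t => tcatrev (thd (ttl (ttl t))) (ttl (ttl (ttl (ttl t))))).
    by apply: polytime_tcatrev; polytime_basic.
  rewrite /prune_step; polytime_basic.
    apply: polytime_tsubset; polytime_basic.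
    by apply: polytime_tclos; polytime_basic.
  apply: polytime_tgreedy; polytime_basic.
  apply: polytime_tsubset; polytime_basic.
  by apply: polytime_tclos; polytime_basic.
Qed.

Lemma polytime_toptimize : polytime toptimize.
Proof.
rewrite /toptimize; polytime_basic; apply: polytime_tprune.
apply: (polytime_foldl (h := saturate_step)); polytime_basic.
  exact: additive_cons polytime_saturate_imp.
rewrite /saturate_step; polytime_basic.
have p : polytime (fun t => Cons (thd t) (thd (ttl t))) by polytime_basic.
exact: polytime_comp p polytime_saturate_imp.
Qed.

(** * Correctness of the program on encodings *)

Section Closure.
Variable U : finType.
Implicit Types (F : {set {set U}}) (A B C D X : {set U}).

Lemma sub_clos F A : A \subset clos F A.
Proof. by apply/bigcapsP => C /andP[]. Qed.

Lemma clos_min F A C : C \in F -> A \subset C -> clos F A \subset C.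
Proof. by move=> CF AC; apply: bigcap_inf; rewrite CF. Qed.

Lemma closS F A B : A \subset B -> clos F A \subset clos F B.
Proof.
move=> AB; apply/bigcapsP => C /andP[CF BC].
by apply: clos_min => //; apply: subset_trans AB BC.
Qed.

Lemma clos_in F A : closure_system F -> clos F A \in F.
Proof.
move=> [FT FI]; rewrite /clos; apply: (big_ind (fun X => X \in F)) => //.
by move=> C /andP[].
Qed.

Lemma clos_id F C : C \in F -> clos F C = C.
Proof. by move=> CF; apply/eqP; rewrite eqEsubset sub_clos clos_min. Qed.

(** * Closure under implications by forward chaining *)

Definition models (L : seq (implication U)) : {set {set U}} :=
  [set X : {set U} | all (satisfies X) L].

Lemma modelsP L X :
  reflect (forall i : implication U, i \in L -> i.1 \subset X -> i.2 \subset X)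
          (X \in models L).
Proof.
rewrite inE; apply: (iffP allP) => h i iL; first by have /implyP := h i iL.
exact/implyP/h.
Qed.

Lemma models_closure_system L : closure_system (models L).
Proof.
split; first by apply/modelsP => i _ _; apply: subsetT.
move=> A B /modelsP hA /modelsP hB; apply/modelsP => i iL.
by rewrite !subsetI => /andP[/(hA i iL)-> /(hB i iL)->].
Qed.

Definition pass (L : seq (implication U)) X : {set U} :=
  foldl (fun X (i : implication U) => if i.1 \subset X then X :|: i.2 else X) X L.

Lemma sub_pass L X : X \subset pass L X.
Proof.
elim: L X => //= i L IHL X; apply: subset_trans (IHL _).
by case: ifP => // _; apply: subsetUl.
Qed.

Lemma pass_sub_model L X D : D \in models L -> X \subset D -> pass L X \subset D.
Proof.
elim: L X => //= i L IHL X /modelsP hD XD; apply: IHL.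
  by apply/modelsP => j jL; apply: hD; rewrite inE jL orbT.
case: ifP => // iX; rewrite subUset XD hD ?mem_head //; exact: subset_trans XD.
Qed.

Lemma pass_fixed L X : pass L X = X -> X \in models L.
Proof.
elim: L X => [|i L IHL] X /=; first by move=> _; apply/modelsP.
set Y := if _ then _ else _ => pY.
have YX : Y = X.
  apply/eqP; rewrite eqEsubset -{1}pY sub_pass /=.
  by rewrite /Y; case: ifP => // _; apply: subsetUl.
move: pY; rewrite YX => /IHL/modelsP hX; apply/modelsP => j.
rewrite inE => /orP[/eqP->|]; last exact: hX.
by move=> iX; move: YX; rewrite /Y iX => <-; apply: subsetUr.
Qed.

(** A pass that changes the set adds a point, so after [#|U|] passes either a model has been reached
    or the set is all of [U], which is a model too. *)
Lemma iter_pass L X : iter #|U| (pass L) X = clos (models L) X.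
Proof.
apply/eqP; rewrite eqEsubset; apply/andP; split.
  elim: #|U| => [|n IHn] /=; first exact: sub_clos.
  by apply: pass_sub_model IHn; apply/clos_in/models_closure_system.
apply: clos_min; last first.
  by elim: #|U| => //= n IHn; apply: subset_trans IHn (sub_pass _ _).
have grow n : iter n (pass L) X \in models L \/ n <= #|iter n (pass L) X|.
  elim: n => [|n [IHn|IHn]] /=; first by right.
    left; rewrite (_ : pass L _ = iter n (pass L) X) //.
    by apply/eqP; rewrite eqEsubset sub_pass pass_sub_model.
  case: (eqVneq (pass L (iter n (pass L) X)) (iter n (pass L) X)) => [e|ne].
    by left; rewrite e pass_fixed.
  right; apply: leq_ltn_trans IHn _; apply: proper_card.
  by rewrite properEneq eq_sym ne sub_pass.
case: (grow #|U|) => // full.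
suff -> : iter #|U| (pass L) X = [set: U] by have [] := models_closure_system L.
by apply/eqP; rewrite eqEcard subsetT cardsT.
Qed.

(** * The optimization algorithm on sets *)

Definition greedy_del (test : pred {set U}) A x : {set U} :=
  if test (A :\ x) then A :\ x else A.

Definition greedy (test : pred {set U}) A : {set U} :=
  foldl (greedy_del test) A (enum U).

Definition saturate (L : seq (implication U)) (i : implication U) : implication U :=
  (greedy (fun A => i.1 \subset clos (models L) A) i.1, clos (models L) i.1).

(** Up to order, [catrev D T'] is the current base without [i]: the implications in [D] occur in
    their shortened form, so each test refers to the current base. *)
Fixpoint prune (D T : seq (implication U)) : seq (implication U) :=
  if T is i :: T' then
    if i.2 \subset clos (models (catrev D T')) i.1 then prune D T'
    else prune ((i.1, greedy (fun B =>
      i.2 \subset clos (models ((i.1, B) :: catrev D T')) i.1) i.2) :: D) T'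
  else D.

Definition optimize (L : seq (implication U)) : seq (implication U) :=
  prune [::] (foldl (fun acc i => saturate L i :: acc) [::] L).

End Closure.

(** * Agreement of the tree program with the algorithm on sets *)

Section Encoding.
Variable U : finType.
Implicit Types (A B C D X : {set U}) (s p : seq U).

Local Notation enc_imps := (enc_list (@enc_implication U)).

Lemma tfoldl_enc (T : Type) (enc : T -> tree) h (s : seq T) a :
  tfoldl h (enc_list enc s) a = foldl (fun acc x => h (enc x) acc) a s.
Proof. by elim: s a => //= x s IHs a; rewrite IHs. Qed.

Lemma tcatrev_enc (T : Type) (enc : T -> tree) (s s' : seq T) :
  tcatrev (enc_list enc s) (enc_list enc s') = enc_list enc (catrev s s').
Proof. by rewrite /tcatrev; elim: s s' => //= x s IHs s'; rewrite -IHs. Qed.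

Definition bits A s : tree := enc_list enc_bool [seq x \in A | x <- s].

Lemma tsubset_enc A X : tsubset (enc_set A) (enc_set X) = enc_bool (A \subset X).
Proof.
have h s v : ttl (tfoldl (subset_step Nil) (bits A s) (Cons (bits X s) v)) =
    if all (fun x => (x \in A) ==> (x \in X)) s then v else Nil.
  elim: s v => //= x s IHs v; rewrite /bits /= in IHs *.
  rewrite /subset_step /= in IHs *; rewrite IHs.
  by case: (x \in A); case: (x \in X) => //=; case: all.
rewrite /tsubset -/(bits A _) -/(bits X _) h.
suff -> : all (fun x => (x \in A) ==> (x \in X)) (enum U) = (A \subset X).
  by case: (_ \subset _).
apply/allP/subsetP => [hA x xA|hA x _]; last exact/implyP/hA.
by have := hA x; rewrite mem_enum xA /=; apply.
Qed.

Lemma tunion_enc X B : tunion (enc_set X) (enc_set B) = enc_set (X :|: B).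
Proof.
have h s (o : seq bool) :
    tfoldl (union_step Nil) (bits X s) (Cons (bits B s) (enc_list enc_bool o)) =
    Cons Nil (enc_list enc_bool (catrev [seq x \in X :|: B | x <- s] o)).
  elim: s o => //= x s IHs o; rewrite -IHs /union_step /=.
  congr (tfoldl _ _ (Cons _ (Cons _ _))).
  by rewrite in_setU; case: (x \in X).
rewrite /tunion -/(bits X _) -/(bits B _) (h _ [::]) /=.
by rewrite (tcatrev_enc _ _ [::]) catrevE revK cats0.
Qed.

Lemma tpass_enc L X : tpass (enc_imps L) (enc_set X) = enc_set (pass L X).
Proof.
rewrite /tpass; elim: L X => //= i L IHL X; rewrite -IHL; congr tfoldl.
rewrite /pass_step /= tsubset_enc tunion_enc.
by case: (i.1 \subset X).
Qed.

Lemma tclos_enc L X : tclos (enc_imps L) (enc_set X) = enc_set (clos (models L) X).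
Proof.
rewrite /tclos tfoldl_enc -iter_pass cardT -(size_map (fun x => x \in X)).
move: [seq _ | x <- _] => l; elim: l X => //= b l IHl X.
by rewrite /clos_step tpass_enc IHl -iterSr.
Qed.

Lemma tgreedy_enc ttest env (test : pred {set U}) A :
    (forall B, ttest env (enc_set B) = enc_bool (test B)) ->
  tgreedy ttest env (enc_set A) = enc_set (greedy test A).
Proof.
move=> httest.
(* Here [p] is the processed part of [enum U] and [D] the current set; deleting the next point
   changes no other bit, since [enum U] has no duplicates. *)
have h s p D : p ++ s = enum U ->
    tfoldl (greedy_step ttest env) (bits D s)
      (Cons (enc_list enc_bool (rev [seq x \in D | x <- p])) (bits D s)) =
    Cons (enc_list enc_bool (rev [seq x \in foldl (greedy_del test) D s | x <- enum U]))
         Nil.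
  elim: s p D => [|x s IHs] p D; first by rewrite cats0 => ->.
  move=> def; have : uniq (p ++ x :: s) by rewrite def enum_uniq.
  rewrite cat_uniq /= => /and3P[_ /norP[xNp _] /andP[xNs _]].
  have agree (q : seq U) : x \notin q ->
      [seq y \in D :\ x | y <- q] = [seq y \in D | y <- q].
    move=> xNq; apply/eq_in_map => y yq; rewrite !inE.
    by case: eqP => // yx; rewrite yx (negbTE xNq) in yq.
  rewrite /= -(IHs (rcons p x) (greedy_del test D x)); last by rewrite cat_rcons.
  rewrite {2}/greedy_step /=.
  have -> : tcatrev (enc_list enc_bool (rev [seq y \in D | y <- p]))
      (Cons Nil (enc_list enc_bool [seq y \in D | y <- s])) = enc_set (D :\ x).
    rewrite (tcatrev_enc _ _ (false :: _)) catrevE revK -agree // -(agree s) //.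
    by rewrite /enc_set -def map_cat /= !inE eqxx.
  rewrite httest map_rcons rev_rcons /greedy_del /bits /=.
  by case: ifP => _ /=; rewrite ?agree // !inE eqxx.
rewrite /tgreedy -[enc_set A]/(bits A (enum U)) (h (enum U) [::] A) //=.
by rewrite (tcatrev_enc _ _ [::]) catrevE revK cats0.
Qed.

Lemma saturate_enc L i :
  saturate_imp (Cons (enc_imps L) (enc_implication i)) = enc_implication (saturate L i).
Proof.
rewrite /saturate_imp /= tclos_enc; congr Cons; apply: tgreedy_enc => B.
by rewrite /premise_test /= tclos_enc tsubset_enc.
Qed.

Lemma tprune_enc T : tprune (enc_imps T) = enc_imps (prune [::] T).
Proof.
rewrite /tprune -[Cons Nil]/(Cons (enc_imps [::])).
suff h (D : seq (implication U)) :
    tfoldl (prune_step Nil) (enc_imps T) (Cons (enc_imps D) (enc_imps T)) =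
    Cons (enc_imps (prune D T)) Nil by rewrite h.
elim: T D => [|i T IHT] D //=.
rewrite {2}/prune_step /= tcatrev_enc tclos_enc tsubset_enc.
case: (_ \subset _) => /=; first exact: IHT.
rewrite (@tgreedy_enc _ _ (fun B =>
   i.2 \subset clos (models ((i.1, B) :: catrev D T)) i.1)) //.
  by rewrite -IHT.
by move=> B; rewrite /conclusion_test /= (tclos_enc ((i.1, B) :: _)) tsubset_enc.
Qed.

Lemma toptimize_enc (L : seq (implication U)) :
  toptimize (enc_base L) = enc_base (optimize L).
Proof.
rewrite /toptimize /enc_base /=; congr Cons; rewrite tfoldl_enc -tprune_enc.
congr tprune; rewrite -[Nil]/(enc_imps [::]).
elim: {2 4}L [::] => //= i L' IHL' acc.
by rewrite {2}/saturate_step saturate_enc -IHL'.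
Qed.

End Encoding.

(** * Quasi-closed sets in convex geometries *)

Section QuasiClosed.
Variables (U : finType) (F : {set {set U}}).
Hypothesis hF : convex_geometry F.
Implicit Types (A B C D Q X : {set U}).

Local Notation ex := Defs.ex.

Let csF : closure_system F. Proof. by case: hF. Qed.

Lemma ex_sub C : ex F C \subset C.
Proof. by apply/subsetP => x; rewrite inE => /andP[]. Qed.

(** If an extreme point [x] were outside [A], then [A] would lie in [C :\ x], whose closure misses
    [x]. *)
Lemma ex_generator A C : C \in F -> clos F A = C -> ex F C \subset A.
Proof.
move=> CF defC; apply/subsetP => x; rewrite inE => /andP[xC].
apply: contraR => xNA; have AC : A \subset C :\ x.
  by rewrite subsetD1 xNA -defC sub_clos.
by have /subsetP := closS F AC; rewrite defC; apply.
Qed.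

Lemma ex_heredity C D x : D \subset C -> x \in D -> x \in ex F C -> x \in ex F D.
Proof.
move=> DC xD; rewrite !inE xD => /andP[_] /=; apply: contra.
by apply/subsetP/closS/setSD.
Qed.

Lemma ex_closedD1 C x : C \in F -> x \in ex F C -> C :\ x \in F.
Proof.
move=> CF; rewrite inE => /andP[xC xN].
suff -> : C :\ x = clos F (C :\ x) by exact: clos_in.
apply/eqP; rewrite eqEsubset sub_clos /= subsetD1 xN andbT.
by apply: clos_min; rewrite // subD1set.
Qed.

Lemma closedD1_ex C x : x \in C -> C :\ x \in F -> x \in ex F C.
Proof. by move=> xC CxF; rewrite inE xC clos_id // !inE eqxx. Qed.

(* A maximal closed set that contains [ex F C] but not [C] can be enlarged by a
   single point, which would then be an extreme point of [C]. *)
Lemma clos_ex C : C \in F -> clos F (ex F C) = C.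
Proof.
move=> CF; apply/eqP; rewrite eqEsubset clos_min ?ex_sub //=.
apply/negPn/negP => CN.
pose P M := (M \in F) && (ex F C \subset M) && ~~ (C \subset M).
have [|M /maxsetP[/andP[/andP[MF exM] CNM] maxM] _] :=
  @maxset_exists _ P (clos F (ex F C)).
  by rewrite /P clos_in // sub_clos.
have [_ _ step] := hF.
have [|x xNM xMF] := step M MF.
  by apply: contraNneq CNM => ->; apply: subsetT.
have CxM : C \subset x |: M.
  apply: contraNT xNM => CNxM; suff <- : x |: M = M by rewrite setU11.
  apply: maxM; last exact: subsetUr.
  by rewrite /P xMF CNxM (subset_trans exM) ?subsetUr.
have CM : C :&: M = C :\ x.
  apply/setP => y; have := subsetP CxM y; rewrite !inE.
  case: (eqVneq y x) => [->|yx] /=; first by rewrite (negbTE xNM) andbF.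
  by case: (y \in C) => // ->.
have xC : x \in C.
  apply: contraNT CNM => xNC; apply/setIidPl; rewrite CM.
  by apply/setP => y; rewrite !inE; case: eqP => // ->; rewrite (negbTE xNC).
suff xex : x \in ex F C by rewrite (subsetP exM) in xNM.
by apply: closedD1_ex => //; rewrite -CM; case: csF => _; apply.
Qed.

(** For extreme [e], the closure of [Q :\ e] misses [e], so it is proper and quasi-closedness keeps
    it inside [Q]. Conversely, a subset [A] of [Q] with proper closure misses some extreme [e] by
    [clos_ex], so its closure stays in the closed set [Q :\ e]. *)
Lemma quasi_closed_ofP C Q : C \in F ->
  reflect [/\ ex F C \subset Q, Q \proper C &
              forall e, e \in ex F C -> Q :\ e \in F]
          (quasi_closed_of F C Q).
Proof.
move=> CF; apply: (iffP idP) => [/andP[/andP[QN /forallP hQ] /eqP defC]|].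
  have QC : Q \subset C by rewrite -defC sub_clos.
  split; first exact: ex_generator.
    by rewrite properEneq QC andbT; apply: contraNneq QN => ->.
  move=> e eC; suff -> : Q :\ e = clos F (Q :\ e) by exact: clos_in.
  have eN : e \notin clos F (Q :\ e).
    move: eC; rewrite inE => /andP[_]; apply: contra.
    by apply/subsetP/closS/setSD.
  apply/eqP; rewrite eqEsubset sub_clos /= subsetD1 eN andbT.
  move: (hQ (Q :\ e)); rewrite subD1set /= => /implyP; apply.
  rewrite properEneq closS ?subD1set // andbT defC.
  by apply: contraNneq eN => ->; apply: (subsetP (ex_sub C)).
move=> [exQ /andP[QC CNQ] hQ].
have defC : clos F Q = C.
  apply/eqP; rewrite eqEsubset clos_min //=.
  by rewrite -{1}(clos_ex CF); apply: closS.
rewrite /quasi_closed_of defC eqxx andbT /quasi_closed; apply/andP; split.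
  by apply: contra CNQ => QF; rewrite -defC clos_min.
apply/forallP => A; apply/implyP => AQ; rewrite defC; apply/implyP => /andP[_ CNA].
have [|e eC eNA] := subsetPn (_ : ~~ (ex F C \subset A)).
  by apply: contra CNA => exA; rewrite -{1}(clos_ex CF); apply: closS.
apply: subset_trans (subD1set Q e).
by apply: clos_min; rewrite ?hQ // subsetD1 AQ.
Qed.

(** * Disjoint edges in acceptant, acyclic and double-shelling geometries *)

Lemma trivIset_qc_edges C :
    (forall Q1 Q2 x, maxset (quasi_closed_of F C) Q1 ->
       maxset (quasi_closed_of F C) Q2 ->
       x \in C -> x \notin Q1 -> x \notin Q2 -> Q1 = Q2) ->
  trivIset (qc_edges F C).
Proof.
move=> h; apply/trivIsetP => _ _ /imsetP[Q1 max1 ->] /imsetP[Q2 max2 ->].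
apply: contraR; rewrite -setI_eq0 => /set0Pn[x].
rewrite !inE in max1 max2 * => /andP[/andP[x1 xC] /andP[x2 _]].
by rewrite (h Q1 Q2 x).
Qed.

Lemma trivIset_qc_edges_total C :
    (forall Q1 Q2, quasi_closed_of F C Q1 -> quasi_closed_of F C Q2 ->
       (Q1 \subset Q2) || (Q2 \subset Q1)) ->
  trivIset (qc_edges F C).
Proof.
move=> h; apply: trivIset_qc_edges => Q1 Q2 x /maxsetP[q1 max1] /maxsetP[q2 max2] _ _ _.
by case/orP: (h _ _ q1 q2) => [/max1 <-|/max2 ->].
Qed.

(** Let [D] be the closure of [(Q1 :|: Q2) :\ e] for an extreme [e]. By acceptance [D] has at most
    one extreme point outside [ex F C], and that point lies in [Q1] or [Q2]. So one of the two
    contains [ex F D]; as it is closed after removing [e], it contains [D] and thus the other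
    set. *)
Lemma acceptant_trivIset C : acceptant F -> C \in F -> trivIset (qc_edges F C).
Proof.
move=> [q [/andP[q_gt0 _] hq]] CF; apply: trivIset_qc_edges_total => Q1 Q2.
move=> /(quasi_closed_ofP _ CF)[ex1 pr1 F1] /(quasi_closed_ofP _ CF)[ex2 pr2 F2].
have [e eC] : exists e, e \in ex F C.
  by apply/card_gt0P; rewrite hq //; have := proper_card pr1; lia.
set D := clos F ((Q1 :|: Q2) :\ e).
have DF : D \in F by exact: clos_in.
have DCe : D \subset C :\ e.
  apply: clos_min; first exact: ex_closedD1.
  by rewrite setSD // subUset !proper_sub.
have [DC eND] : D \subset C /\ e \notin D by apply/andP; rewrite -subsetD1.
have exD : ex F D \subset (Q1 :|: Q2) :\ e by exact: ex_generator.
have exCD : ex F C :\ e \subset ex F D.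
  apply/subsetP => x xC; have [xe xex] := setD1P xC.
  apply: (ex_heredity DC) => //; apply: (subsetP (sub_clos _ _)).
  by rewrite !inE xe (subsetP ex1).
have le1 : #|ex F D :\: (ex F C :\ e)| <= 1.
  have := subset_leq_card DC; have := cardsD1 e (ex F C); rewrite eC.
  have := cardsID (ex F C :\ e) (ex F D); rewrite (setIidPr exCD).
  rewrite (hq D) // (hq C) //; lia.
have main Q Q' : Q' :\ e \subset D -> ex F C \subset Q -> Q :\ e \in F ->
    ex F D \subset Q -> Q' \subset Q.
  move=> Q'D exQ QF DQ; rewrite -(setD1K (subsetP exQ _ eC)) -subDset -/(Q' :\ e).
  apply: subset_trans Q'D _; rewrite -(clos_ex DF); apply: clos_min => //.
  by rewrite subsetD1 DQ; apply: contra eND; apply/subsetP/ex_sub.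
have subD Q : Q \subset Q1 :|: Q2 -> Q :\ e \subset D.
  by move=> sub; apply: subset_trans (sub_clos _ _); apply: setSD.
have [h1|/subsetPn[g1 g1D g1N]] := boolP (ex F D \subset Q1).
  by rewrite (main Q1 Q2) ?orbT ?subD ?subsetUr ?F1.
have [h2|/subsetPn[g2 g2D g2N]] := boolP (ex F D \subset Q2).
  by rewrite (main Q2 Q1) ?subD ?subsetUl ?F2.
have g12 : g1 != g2.
  apply: contraNneq g2N => <-; have := subsetP exD _ g1D.
  by rewrite !inE (negbTE g1N) => /andP[].
suff : #|[set g1; g2]| <= 1 by rewrite cards2 g12.
apply: leq_trans le1; apply: subset_leq_card.
have gC g Q : ex F C \subset Q -> g \notin Q -> g \in ex F D ->
    g \in ex F D :\: (ex F C :\ e).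
  move=> exQ gN gD; rewrite in_setD gD andbT.
  by apply: contra gN => /setD1P[_]; apply: (subsetP exQ).
by apply/subsetP => x /set2P[]->; [apply: gC ex1 _ _|apply: gC ex2 _ _].
Qed.

Lemma exists_source (r : rel U) (E : {set U}) x0 :
    (forall c, c != [::] -> ~~ cycle r c) -> x0 \in E ->
  exists2 x, x \in E & forall a, a \in E -> ~~ r a x.
Proof.
move=> acyc x0E.
(* The point [x] has the fewest ancestors; an arc into it from [a] in [E] would make both ancestor
   sets equal, so [x] would reach [a] and close a cycle. *)
case: (@arg_minnP _ x0 (fun x => x \in E) (fun x => #|[set z | connect r z x]|) x0E).
move=> x xE xmin; exists x => // a aE; apply/negP => rax.
have le := xmin a aE.
have sub : [set z | connect r z a] \subset [set z | connect r z x].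
  by apply/subsetP => z; rewrite !inE => za; apply: connect_trans za (connect1 rax).
have : x \in [set z | connect r z a].
  suff -> : [set z | connect r z a] = [set z | connect r z x] by rewrite inE connect0.
  by apply/eqP; rewrite eqEcard sub.
rewrite inE => /connectP[p rp lastp].
have /negP := acyc (x :: p) isT; apply.
by rewrite /= rcons_path rp -lastp.
Qed.

(** Take a source [y] of the implication graph on [C :\: Q]. Premises inside [C] of implications
    concluding [y] lie in [Q], which makes [C :\ y] quasi-closed; maximality gives [Q = C :\ y], and
    the missed point [x] must be [y]. *)
Lemma acyclic_trivIset C : acyclic F -> C \in F -> trivIset (qc_edges F C).
Proof.
move=> [S [baseS _ acyc]] CF.
have models_F X : (X \in F) = (X \in models S) by rewrite baseS.
apply: trivIset_qc_edges => Q1 Q2 x max1 max2 xC x1 x2.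
suff single Q : maxset (quasi_closed_of F C) Q -> x \notin Q -> Q = C :\ x.
  by rewrite (single Q1) // (single Q2).
move=> {Q1 Q2 max1 max2 x1 x2} /maxsetP[qQ maxQ] xNQ.
have [y yE ysrc] := @exists_source (implication_graph S) (C :\: Q) x acyc
  ltac:(by rewrite in_setD xNQ).
have [yC yNQ] := setDP yE.
have [exQ /andP[QC _] _] := quasi_closed_ofP _ CF qQ.
have [/andP[_ /forallP closQ] /eqP defQ] := andP qQ.
have before (i : implication U) : i \in S -> i.1 \subset C -> y \in i.2 -> i.1 \subset Q.
  move=> iS iC yi; apply/subsetP => a ai; apply: contraT => aNQ.
  have := ysrc a; rewrite in_setD aNQ (subsetP iC) // => /(_ isT)/negP[].
  by apply/hasP; exists i; rewrite ?ai.
have QCy : Q \subset C :\ y by rewrite subsetD1 QC.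
have defCy : clos F (C :\ y) = C.
  apply/eqP; rewrite eqEsubset clos_min ?subD1set //=.
  by rewrite -{1}defQ closS.
have qCy : quasi_closed_of F C (C :\ y).
  rewrite /quasi_closed_of defCy eqxx andbT; apply/andP; split.
    by apply/negP => /clos_id; rewrite defCy => /setP/(_ y); rewrite !inE eqxx yC.
  apply/forallP => A; apply/implyP => ACy; rewrite defCy; apply/implyP => prA.
  rewrite subsetD1 (proper_sub prA) /=.
  (* An implication with premise in [clos F A] that concludes [y] has its premise in [Q] by
     [before]; its closure would then lie in [Q], which misses [y]. *)
  suff clF : clos F A :\ y \in F.
    have [_ yNA] : A \subset C /\ y \notin A by apply/andP; rewrite -subsetD1.
    have : clos F A \subset clos F A :\ y by rewrite clos_min // subsetD1 sub_clos.
    by rewrite subsetD1 => /andP[].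
  have AF : clos F A \in models S by rewrite -models_F clos_in.
  rewrite models_F; apply/modelsP => i iS iA.
  have iA' : i.1 \subset clos F A := subset_trans iA (subD1set _ _).
  have iA2 : i.2 \subset clos F A by move/modelsP: AF => /(_ i iS iA').
  rewrite subsetD1 iA2 /=; apply: contra yNQ => yi.
  have iQ := before i iS (subset_trans iA' (proper_sub prA)) yi.
  have := closQ i.1; rewrite iQ defQ /= => /implyP h.
  have {}h : clos F i.1 \subset Q.
    by apply: h; apply: sub_proper_trans prA; apply: clos_min; rewrite ?clos_in.
  apply: (subsetP h).
  have /modelsP : clos F i.1 \in models S by rewrite -models_F clos_in.
  by move=> /(_ i iS (sub_clos _ _))/subsetP; apply.
have defQy := maxQ _ qCy QCy.
suff <- : y = x by [].
by apply/eqP; move: xNQ; rewrite -defQy !inE xC andbT negbK eq_sym.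
Qed.

Lemma exists_minimal (le : rel U) C x :
    reflexive le -> antisymmetric le -> transitive le -> x \in C ->
  exists m, [/\ m \in C, le m x & forall z, z \in C -> le z m -> z = m].
Proof.
move=> refl anti trans xC.
have x0 : (x \in C) && le x x by rewrite xC refl.
case: (@arg_minnP _ x (fun m => (m \in C) && le m x)
         (fun m => #|[set z in C | le z m]|) x0) => m /andP[mC mx] mmin.
exists m; split=> // z zC zm.
have le_mz : #|[set z in C | le z m]| <= #|[set y in C | le y z]|.
  by apply: mmin; rewrite zC (trans m).
have sub : [set y in C | le y z] \subset [set z in C | le z m].
  by apply/subsetP => y; rewrite !inE => /andP[-> yz]; apply: trans yz zm.
have : m \in [set y in C | le y z].
  suff -> : [set y in C | le y z] = [set z in C | le z m] by rewrite inE mC refl.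
  by apply/eqP; rewrite eqEcard sub.
by rewrite inE => /andP[_ mz]; apply: anti; rewrite zm.
Qed.

(** A minimal [a] below [x] and a maximal [b] above it are extreme. A further extreme [e] would
    leave [a] and [b] in the convex set [Q1 :\ e], forcing [x] into [Q1]; so [a] and [b] are the
    only ones. Then [Q1 :|: Q2] is quasi-closed, and maximality identifies both sets with it. *)
Lemma double_shelling_trivIset C :
  double_shelling F -> C \in F -> trivIset (qc_edges F C).
Proof.
move=> [le [refl anti trans defF]] CF.
have convexP X : reflect (forall u v z, u \in X -> v \in X -> le u v -> u != v ->
    le u z -> le z v -> z \in X) (X \in F).
  rewrite defF inE; apply: (iffP idP) => [/forall_inP cX u v z uX vX uv nuv uz zv|cX].
    have /forall_inP/(_ v vX) := cX u uX; rewrite uv nuv => /subsetP; apply.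
    by rewrite inE uz zv.
  apply/forall_inP => u uX; apply/forall_inP => v vX; apply/implyP => /andP[uv nuv].
  by apply/subsetP => z; rewrite inE => /andP[]; apply: cX uX vX uv nuv.
have minmax_ex m : m \in C ->
    (forall u v, u \in C -> v \in C -> le u m -> le m v -> u = m \/ v = m) ->
    m \in ex F C.
  move=> mC hm; apply: closedD1_ex => //; apply/convexP => u v z.
  rewrite !inE => /andP[um uC] /andP[vm vC] uv nuv uz zv.
  rewrite (convexP C CF u v z) // andbT; apply: contraTneq isT => zm.
  by move: uz zv; rewrite zm => uz zv; have [e|e] := hm u v uC vC uz zv;
    rewrite e eqxx in um vm.
have min_ex m : m \in C -> (forall z, z \in C -> le z m -> z = m) -> m \in ex F C.
  by move=> mC hm; apply: minmax_ex => // u v uC _ um _; left; apply: hm.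
have max_ex m : m \in C -> (forall z, z \in C -> le m z -> z = m) -> m \in ex F C.
  by move=> mC hm; apply: minmax_ex => // u v _ vC _ mv; right; apply: hm.
have exists_min x : x \in C ->
    exists m, [/\ m \in C, le m x & forall z, z \in C -> le z m -> z = m].
  exact: exists_minimal.
have exists_max x : x \in C ->
    exists m, [/\ m \in C, le x m & forall z, z \in C -> le m z -> z = m].
  apply: (@exists_minimal (fun u v => le v u)) => //.
    by move=> u v /andP[? ?]; apply: anti; apply/andP.
  by move=> u v w ? ?; apply: trans; eassumption.
apply: trivIset_qc_edges => Q1 Q2 x /maxsetP[q1 max1] /maxsetP[q2 max2] xC x1 x2.
have [ex1 /andP[QC1 _] F1] := quasi_closed_ofP _ CF q1.
have [ex2 /andP[QC2 _] F2] := quasi_closed_ofP _ CF q2.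
have [a [aC ax amin]] := exists_min x xC.
have [b [bC xb bmax]] := exists_max x xC.
have aE := min_ex a aC amin; have bE := max_ex b bC bmax.
have ab : a != b.
  apply: contraNneq x1 => eab; rewrite -eab in xb.
  by rewrite (_ : x = a) ?(subsetP ex1) //; apply: anti; rewrite xb.
have exab e : e \in ex F C -> e = a \/ e = b.
  move=> eE; case: (eqVneq e a) => [|ea]; [by left|]; right; apply/eqP.
  apply: contraNT x1 => eb; apply: (subsetP (subD1set Q1 e)).
  apply: (convexP _ (F1 e eE) a b) => //; last exact: trans ax xb.
    by rewrite !inE eq_sym ea (subsetP ex1).
  by rewrite !inE eq_sym eb (subsetP ex1).
have qU : quasi_closed_of F C (Q1 :|: Q2).
  apply/(quasi_closed_ofP _ CF); split.
  - exact: subset_trans ex1 (subsetUl _ _).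
  - rewrite properE subUset QC1 QC2; apply/subsetPn; exists x => //.
    by rewrite inE negb_or x1.
  - move=> e eE; apply/convexP => u v z; rewrite !inE.
    move=> /andP[ue uQ] /andP[ve vQ] uv nuv uz zv.
    have inC w : (w \in Q1) || (w \in Q2) -> w \in C.
      by case/orP; [apply: (subsetP QC1)|apply: (subsetP QC2)].
    have uC := inC u uQ; have vC := inC v vQ.
    have [eqe|eqe] := exab e eE; rewrite {}eqe in eE ue ve *.
    (* A maximal point above [v] is extreme, hence [b], which lies in both sets. Replacing [v] by
       [b] puts [z] into the set containing [u]. The case [e = b] is dual. *)
    + have [b' [b'C vb' b'max]] := exists_max v vC.
      have {b'C b'max} eb : b' = b.
        case: (exab b' (max_ex b' b'C b'max)) => // b'a; rewrite b'a in vb'.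
        by rewrite (amin v vC vb') eqxx in ve.
      rewrite {}eb in vb'.
      have ub : u != b.
        by apply: contraNneq nuv => ub; rewrite ub in uv *; rewrite (bmax v vC uv).
      have aux Q : Q :\ a \in F -> ex F C \subset Q -> u \in Q -> z \in Q :\ a.
        move=> QF exQ uQ'; apply: (convexP _ QF u b) => //.
        * by rewrite !inE ue.
        * by rewrite !inE eq_sym ab (subsetP exQ).
        * exact: trans uv vb'.
        * exact: trans zv vb'.
      case/orP: uQ => uQ;
        [have := aux Q1 (F1 a eE) ex1 uQ|have := aux Q2 (F2 a eE) ex2 uQ];
        by rewrite !inE => /andP[-> ->]; rewrite ?orbT.
    + have [a' [a'C a'u a'min]] := exists_min u uC.
      have {a'C a'min} ea : a' = a.
        case: (exab a' (min_ex a' a'C a'min)) => // a'b; rewrite a'b in a'u.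
        by rewrite (bmax u uC a'u) eqxx in ue.
      rewrite {}ea in a'u.
      have va : a != v.
        by apply: contraNneq nuv => va; rewrite -va in uv *; rewrite (amin u uC uv).
      have aux Q : Q :\ b \in F -> ex F C \subset Q -> v \in Q -> z \in Q :\ b.
        move=> QF exQ vQ'; apply: (convexP _ QF a v) => //.
        * by rewrite !inE ab (subsetP exQ).
        * by rewrite !inE ve.
        * exact: trans a'u uv.
        * exact: trans a'u uz.
      case/orP: vQ => vQ;
        [have := aux Q1 (F1 b eE) ex1 vQ|have := aux Q2 (F2 b eE) ex2 vQ];
        by rewrite !inE => /andP[-> ->]; rewrite ?orbT.
by rewrite -(max1 _ qU (subsetUl _ _)) {1}(max2 _ qU (subsetUr _ _)).
Qed.

End QuasiClosed.

(** * Disjoint edges in affine geometries, by exchange in convex hulls *)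

Section Affine.
Import Order.TTheory GRing.Theory Num.Theory.
Local Open Scope ring_scope.
Variables (U : finType) (F : {set {set U}}) (R : realType).
Hypothesis hF : convex_geometry F.
Implicit Types (C Q K : {set U}).

(* Push [x] away from [y] until one barycentric coordinate vanishes. *)
Lemma in_conv_exchange (d : nat) (pt : U -> 'rV[R]_d) K y x :
    in_conv pt K (pt y) -> in_conv pt K (pt x) -> y \notin K ->
  exists2 e, e \in K & in_conv pt (y |: (K :\ e)) (pt x).
Proof.
move=> [la [la0 la1 yE]] [mu [mu0 mu1 xE]] yNK.
have [i0 /andP[i0K i0pos]] : exists i, (i \in K) && (0 < la i).
  apply/existsP; apply: contraT; rewrite negb_exists => /forallP h.
  have : \sum_(i in K) la i = 0.
    apply: big1 => i iK; apply/eqP; rewrite eq_le la0 andbT leNgt.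
    by have := h i; rewrite iK.
  by rewrite la1 => /eqP; rewrite oner_eq0.
pose P i := (i \in K) && (0 < la i).
have Pi0 : P i0 by rewrite /P i0K.
case: (@Order.TotalTheory.arg_minP _ _ _ i0 P (fun i => mu i / la i) Pi0).
move=> e /andP[eK epos] emin; set r := mu e / la e.
have r0 : 0 <= r by rewrite divr_ge0.
have rle k : k \in K -> r * la k <= mu k.
  move=> kK; have [kpos|] := ltP 0 (la k).
    by rewrite -ler_pdivlMr // emin // /P kK.
  move=> kle; have -> : la k = 0 by apply/eqP; rewrite eq_le kle la0.
  by rewrite mulr0.
have re : mu e - r * la e = 0 by rewrite /r divfK ?subrr // gt_eqF.
(* Subtracting [r] times the coordinates of [y] and giving [y] itself the weight [r] represents the
   same point; the least ratio [r] keeps all weights nonnegative and cancels that of [e]. *)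
pose w z := if z == y then r else if z \in K then mu z - r * la z else 0.
have wK z : z \in K -> w z = mu z - r * la z.
  by move=> zK; rewrite /w zK; case: eqP => // zy; rewrite -zy zK in yNK.
have yNKe : y \notin K :\ e by rewrite !inE negb_and yNK orbT.
exists e => //; exists w; split.
- move=> z; rewrite /w; case: eqP => // _; case: ifP => // zK.
  by rewrite subr_ge0 rle.
- rewrite big_setU1 //= {1}/w eqxx.
  rewrite (eq_bigr (fun z => mu z - r * la z)); last by move=> z /setD1P[_ /wK].
  have : \sum_(z in K) (mu z - r * la z) = 1 - r.
    by rewrite sumrB -mulr_sumr mu1 la1 mulr1.
  by rewrite (big_setD1 e) //= re add0r => ->; rewrite addrC subrK.
- rewrite big_setU1 //= {1}/w eqxx.
  rewrite (eq_bigr (fun z => (mu z - r * la z) *: pt z)); last first.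
    by move=> z /setD1P[_ /wK->].
  have : \sum_(z in K) (mu z - r * la z) *: pt z = pt x - r *: pt y.
    rewrite xE yE scaler_sumr -sumrB; apply: eq_bigr => z _.
    by rewrite scalerBl scalerA.
  by rewrite (big_setD1 e) //= re scale0r add0r => ->; rewrite addrC subrK.
Qed.

(** If [Q] had a non-extreme point [y], exchange would put each [x] of [C] in the closure of
    [y |: (ex F C :\ e)] for some extreme [e], hence in the closed set [Q :\ e]; then [Q] would be
    all of [C]. *)
Lemma affine_trivIset C : affine R F -> C \in F -> trivIset (qc_edges F C).
Proof.
move=> [d [pt [_ convP]]] CF.
suff only Q : quasi_closed_of F C Q -> Q = Defs.ex F C.
  by apply: trivIset_qc_edges_total => Q1 Q2 /only-> /only->; rewrite subxx.
move=> /(quasi_closed_ofP hF _ CF)[exQ /andP[QC CNQ] hQ].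
apply/eqP; rewrite eqEsubset exQ andbT; apply: contraNT CNQ => /subsetPn[y yQ yNex].
have conv_ex z : z \in C -> in_conv pt (Defs.ex F C) (pt z).
  by move=> zC; apply/convP; rewrite (clos_ex hF).
apply/subsetP => x xC.
have [e eE /convP] := in_conv_exchange (conv_ex y (subsetP QC _ yQ)) (conv_ex x xC) yNex.
suff : clos F (y |: (Defs.ex F C :\ e)) \subset Q :\ e.
  by move=> /subsetP sub /sub; rewrite inE => /andP[].
apply: clos_min; first exact: hQ.
rewrite subUset sub1set !inE yQ andbT setSD // andbT.
by apply: contraNneq yNex => ->.
Qed.

End Affine.

(** * Minimality of the result *)

Section Optimality.
Variable U : finType.
Implicit Types (F : {set {set U}}) (A B C M Q X : {set U}).
Local Notation ex := Defs.ex.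

Lemma listed_trivIset (R : realType) F C :
  listed_convex_geometry R F -> C \in F -> trivIset (qc_edges F C).
Proof.
move=> [hF [?|?|?|?]] CF.
- exact: double_shelling_trivIset.
- exact: acyclic_trivIset.
- by apply: (@affine_trivIset _ _ R).
- exact: acceptant_trivIset.
Qed.

(** One round suffices: by monotonicity a point that could not be deleted from a larger set cannot
    be deleted from the final one. *)
Lemma greedy_foldlP (test : pred {set U}) A (s : seq U) :
    (forall X X', X \subset X' -> test X -> test X') ->
  let G := foldl (greedy_del test) A s in
  [/\ G \subset A, test A -> test G &
      forall x, x \in s -> x \in G -> ~~ test (G :\ x)].
Proof.
move=> mono; elim: s A => [|x s IHs] A /=; first by split.
have [sub tG minG] := IHs (greedy_del test A x).
have delA : greedy_del test A x \subset A.
  by rewrite /greedy_del; case: ifP => // _; apply: subD1set.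
split; first exact: subset_trans sub delA.
  by move=> tA; apply: tG; rewrite /greedy_del; case: ifP.
move=> y; rewrite inE => /orP[/eqP->|]; last exact: minG.
rewrite /greedy_del in sub *; case: ifPn sub => [_ sub|nt sub] xG.
  by have := subsetP sub x xG; rewrite !inE eqxx.
by apply: contra nt; apply: mono; apply: setSD.
Qed.

Lemma greedyP (test : pred {set U}) A :
    (forall X X', X \subset X' -> test X -> test X') -> test A ->
  [/\ greedy test A \subset A, test (greedy test A) &
      forall x, x \in greedy test A -> ~~ test (greedy test A :\ x)].
Proof.
move=> mono tA; have [sub tG minG] := greedy_foldlP A (enum U) mono.
by split=> // [|x]; [exact: tG|apply: minG; rewrite mem_enum].
Qed.

Lemma eq_models (L L' : seq (implication U)) : L =i L' -> models L = models L'.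
Proof.
move=> eqL; apply/setP => X; apply/modelsP/modelsP => h i iL;
  by apply: h; rewrite ?eqL // -eqL.
Qed.

Lemma models_cons i (L : seq (implication U)) X :
  (X \in models (i :: L)) = satisfies X i && (X \in models L).
Proof. by rewrite !inE. Qed.

Lemma cards_bigcup_seq (T : Type) (s : seq T) (P : pred T) (B : T -> {set U}) :
  #|\bigcup_(i <- s | P i) B i| <= \sum_(i <- s | P i) #|B i|.
Proof.
elim/big_rec2: _ => [|i n X _ le]; first by rewrite cards0.
by apply: leq_trans (leq_card_setU _ _) _; rewrite leq_add2l.
Qed.

(** Distinct keys count each entry at most once. With closures of premises as keys, this adds up the
    local bounds given by [tight]. *)
Lemma sum_partition_leq (T : Type) (K : eqType) (key : T -> K) (ks : seq K)
    (s : seq T) (f : T -> nat) :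
  uniq ks -> \sum_(k <- ks) \sum_(j <- s | key j == k) f j <= \sum_(j <- s) f j.
Proof.
move=> uks; rewrite (exchange_big_dep xpredT) //=; apply: leq_sum => j _.
rewrite big_const_seq iter_addn_0 -[leqRHS]muln1 leq_mul2l.
rewrite (eq_count (a2 := pred1 (key j))); last by move=> k /=; rewrite eq_sym.
by rewrite count_uniq_mem // leq_b1 orbT.
Qed.

Section Geometry.
Variable F : {set {set U}}.
Hypothesis hF : convex_geometry F.

(** A local form of optimality: [i] is charged to those implications of a competing base whose
    premises generate the same closed set. *)
Definition tight (i : implication U) : Prop := forall S, is_base F S ->
  #|i.1| + #|i.2| <=
  \sum_(j <- S | clos F j.1 == clos F i.1) (#|j.1| + #|j.2|).

(* Every base contains, for each quasi-closed set [M] of [C], an implication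
   generating [C] that [M] violates: its conclusion meets the edge [C :\: M].
   The edges through distinct elements of [B] are distinct, hence disjoint. *)
Lemma separated_tight C B :
    C \in F -> trivIset (qc_edges F C) -> B \subset C -> B != set0 ->
    (forall y, y \in B -> exists M,
       [/\ maxset (quasi_closed_of F C) M, y \notin M & B :\ y \subset M]) ->
  tight (ex F C, B).
Proof.
move=> CF triv BC /set0Pn[y0 y0B] sep S baseS; rewrite /= (clos_ex hF) //.
have modelsS X : (X \in F) = (X \in models S) by rewrite baseS.
pose key (j : implication U) := clos F j.1 == C.
pose Bs := \bigcup_(j <- S | key j) j.2.
have hit M : quasi_closed_of F C M ->
    exists j z, [/\ j \in S, key j, z \in j.2, z \in C & z \notin M].
  move=> /andP[/andP[MN /forallP hM] /eqP defM].
  have : ~~ all (satisfies M) S by move: MN; rewrite modelsS inE.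
  move=> /allPn[j jS]; rewrite negb_imply => /andP[jM /subsetPn[z zj zM]].
  have j2 : j.2 \subset clos F j.1.
    have : clos F j.1 \in models S by rewrite -modelsS clos_in //; case: hF.
    by move=> /modelsP/(_ j jS (sub_clos _ _)).
  have jC : clos F j.1 \subset C by rewrite -defM closS.
  exists j, z; split=> //; last exact: subsetP (subset_trans j2 jC) _ zj.
  apply: contraNT zM => ne; have := hM j.1; rewrite jM defM properEneq ne jC /=.
  by move=> sub; apply: (subsetP (subset_trans j2 sub)).
have [f hf] : exists f : U -> U, forall y, y \in B -> f y \in Bs /\ exists M,
    [/\ maxset (quasi_closed_of F C) M, y \notin M, B :\ y \subset M & f y \in C :\: M].
  apply: (@fin_all_exists U (fun=> U) (fun y z => y \in B -> z \in Bs /\ exists M,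
    [/\ maxset (quasi_closed_of F C) M, y \notin M, B :\ y \subset M & z \in C :\: M])).
  move=> y; have [yB|_] := boolP (y \in B); last by exists y.
  have [M [maxM yM sub]] := sep y yB; have [qM _] := maxsetP maxM.
  have [j [z [jS kj zj zC zM]]] := hit M qM.
  exists z => _; split; last by exists M; rewrite in_setD zM.
  by rewrite /Bs (big_rem j) //= kj inE zj.
have finj : {in B &, injective f}.
  move=> y y' yB y'B eqf; apply/eqP/negPn/negP => ne.
  have [_ [M [maxM yM sub fM]]] := hf y yB.
  have [_ [M' [maxM' yM' sub' fM']]] := hf y' y'B.
  have y'M : y' \in M by apply: (subsetP sub); rewrite !inE eq_sym ne.
  have neE : C :\: M != C :\: M'.
    apply/eqP => /setP/(_ y'); rewrite !in_setD y'M yM' /=.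
    by rewrite (subsetP BC) // y'B.
  have edge N : maxset (quasi_closed_of F C) N -> C :\: N \in qc_edges F C.
    by move=> maxN; apply/imsetP; exists N; rewrite ?inE.
  have := trivIsetP triv _ _ (edge M maxM) (edge M' maxM') neE.
  by move=> /pred0P/(_ (f y)); rewrite /= fM eqf fM'.
have leB : #|B| <= \sum_(j <- S | key j) #|j.2|.
  rewrite -(card_in_imset finj); apply: leq_trans (cards_bigcup_seq _ _ _).
  by apply: subset_leq_card; apply/subsetP => _ /imsetP[y yB ->]; case: (hf y yB).
have leA : #|ex F C| <= \sum_(j <- S | key j) #|j.1|.
  have [M [/maxsetP[qM _] _ _]] := sep y0 y0B.
  have [j [_ [jS kj _ _ _]]] := hit M qM.
  rewrite (big_rem j) //= kj; apply: leq_trans (leq_addr _ _).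
  by apply/subset_leq_card/ex_generator/eqP.
by rewrite big_split /= leq_add.
Qed.

Definition saturated (i : implication U) : bool :=
  (i.2 \in F) && (i.1 == ex F i.2).

(** The extreme points form the least generating set of a closed set, so a greedily minimized
    premise is exactly that set. *)
Lemma saturate_saturated L i : is_base F L -> i \in L ->
  saturated (saturate L i) /\ (saturate L i).2 = clos F i.1.
Proof.
move=> baseL iL; have -> : saturate L i =
    (greedy (fun A => i.1 \subset clos F A) i.1, clos F i.1) by rewrite baseL.
have CF : clos F i.1 \in F by apply: clos_in; case: hF.
split=> //; rewrite /saturated /= CF /=.
have [|sub test min] := @greedyP (fun A => i.1 \subset clos F A) i.1 _ (sub_clos _ _).
  by move=> X X' XX'; move=> h; apply: subset_trans h (closS _ XX').
set G := greedy _ _ in sub test min *.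
have defG : clos F G = clos F i.1.
  by apply/eqP; rewrite eqEsubset closS // clos_min // clos_in //; case: hF.
rewrite eqEsubset (ex_generator CF defG) andbT; apply/subsetP => x xG.
apply: contraT => xN; have /negP[] := min x xG.
apply: subset_trans (sub_clos F _) _; rewrite -{1}(clos_ex hF CF); apply: closS.
by rewrite subsetD1 xN (ex_generator CF defG).
Qed.

Lemma is_base_saturate L : is_base F L ->
  is_base F (rev [seq saturate L i | i <- L]).
Proof.
move=> baseL; rewrite /is_base -/(models _).
rewrite (@eq_models _ [seq saturate L i | i <- L]); last by move=> i; rewrite mem_rev.
apply/setP => X; have modelsL : (X \in F) = (X \in models L) by rewrite baseL.
apply/idP/modelsP => [XF _ /mapP[i iL ->]|h].
  have [/andP[CF /eqP->] _] := saturate_saturated baseL iL.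
  by rewrite -{2}(clos_ex hF CF); apply: clos_min.
rewrite modelsL; apply/modelsP => i iL iX.
have [/andP[CF /eqP e1] e2] := saturate_saturated baseL iL.
have := h _ (map_f _ iL); rewrite e1 e2 => hX.
have : clos F i.1 \in models L by rewrite -[models L]baseL -e2.
move=> /modelsP/(_ i iL (sub_clos _ _)) sub.
apply: subset_trans sub (hX _); apply: subset_trans iX.
by apply: (ex_generator) => //; rewrite -e2.
Qed.

(* [R] stands for the implications other than the one being processed. *)
Lemma prune_redundant i (R : seq (implication U)) :
    is_base F (i :: R) -> i.2 \subset clos (models R) i.1 -> is_base F R.
Proof.
move=> base red; rewrite base; apply/setP => X; rewrite -!/(models _) models_cons.
rewrite andb_idl // => XR; apply/implyP => iX.
by apply: subset_trans red _; apply: clos_min.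
Qed.

(** Minimality of [B] means that with conclusion [B :\ y] the premise no longer derives [C]. The set
    [Q] it does derive is quasi-closed, and a maximal quasi-closed set above [Q] separates [y] from
    the rest of [B], as [separated_tight] requires. *)
Lemma prune_reduce i (R : seq (implication U)) :
    is_base F (i :: R) -> saturated i -> trivIset (qc_edges F i.2) ->
    {in R, forall j, j.1 = ex F (clos F j.1)} ->
    ~~ (i.2 \subset clos (models R) i.1) ->
  let B := greedy (fun B => i.2 \subset clos (models ((i.1, B) :: R)) i.1) i.2 in
  is_base F ((i.1, B) :: R) /\ tight (i.1, B).
Proof.
case: i => A C /= base /andP[/= CF /eqP defA] triv exR nred.
have closA : clos F A = C by rewrite defA (clos_ex hF).
have csF : closure_system F by case: hF.
have weak B X : B \subset C -> X \in F -> X \in models ((A, B) :: R).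
  move=> BC; rewrite base -/(models _) !models_cons => /andP[/implyP /= h ->].
  by rewrite andbT; apply/implyP => /h; apply: subset_trans.
pose test B := C \subset clos (models ((A, B) :: R)) A.
have mono X X' : X \subset X' -> test X -> test X'.
  move=> XX' tX; apply: subset_trans tX _; apply: clos_min; last exact: sub_clos.
  have := clos_in A (models_closure_system ((A, X') :: R)).
  rewrite !models_cons => /andP[/implyP /= h ->]; rewrite andbT.
  by apply/implyP => /h; apply: subset_trans.
have testC : test C by rewrite /test -[models _]base closA.
have [] := greedyP mono testC; rewrite -/test.
set B := greedy test C => BC tB minB.
have baseB : is_base F ((A, B) :: R).
  apply/setP => X; apply/idP/idP => [|XB]; first exact: weak.
  rewrite base -/(models _) models_cons; move: (XB); rewrite -/(models _) models_cons.
  case/andP=> _ ->; rewrite andbT; apply/implyP => /= AX.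
  by apply: subset_trans tB (clos_min XB AX).
have memF X : (X \in F) = satisfies X (A, B) && (X \in models R).
  by rewrite {1}baseB -/(models _) models_cons.
split=> //; have B0 : B != set0.
  apply: contraNneq nred => B0; move: tB; rewrite /test B0.
  suff -> : models ((A, set0) :: R) = models R by [].
  by apply/setP => X; rewrite models_cons /satisfies /= sub0set implybT.
rewrite defA; apply: separated_tight => // y yB.
pose Q := clos (models ((A, B :\ y) :: R)) A.
have QM : Q \in models ((A, B :\ y) :: R) by apply/clos_in/models_closure_system.
have AQ : A \subset Q by apply: sub_clos.
have [ByQ QR] : B :\ y \subset Q /\ Q \in models R.
  by move: QM; rewrite models_cons /satisfies /= AQ => /andP[].
have CNQ : ~~ (C \subset Q) by exact: minB.
have yNQ : y \notin Q.
  apply: contra CNQ => yQ; rewrite -closA clos_min // memF QR andbT.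
  by apply/implyP => _ /=; rewrite -(setD1K yB) subUset sub1set yQ.
have QC : Q \subset C.
  apply: clos_min; last by rewrite -closA sub_clos.
  by apply: weak => //; apply: subset_trans (subD1set _ _) BC.
have qQ : quasi_closed_of F C Q.
  have defQ : clos F Q = C.
    by apply/eqP; rewrite eqEsubset clos_min //= -{1}closA closS.
  rewrite /quasi_closed_of defQ eqxx andbT; apply/andP; split.
    by apply: contra CNQ => QF; rewrite -{1}defQ clos_min.
  apply/forallP => X; apply/implyP => XQ; rewrite defQ; apply/implyP => /andP[_ CNX].
  (* The intersection satisfies [R] because both sets do, and [(A, B)] vacuously: if [A] were inside
     [clos F X], so would be [C]. *)
  suff : clos F X :&: Q \in F.
    by move=> h; apply: subset_trans (subsetIr (clos F X) Q);
       apply: clos_min => //; rewrite subsetI sub_clos.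
  have XF : clos F X \in F by exact: clos_in.
  rewrite memF; apply/andP; split.
    apply/implyP => /= AX; case/negP: CNX; rewrite -{1}closA clos_min //.
    exact: subset_trans AX (subsetIl _ _).
  have [_] := models_closure_system R; apply=> //.
  by move: XF; rewrite memF => /andP[].
have [M maxM QM'] := maxset_exists qQ.
exists M; split=> //; last exact: subset_trans ByQ QM'.
have [/andP[/andP[MN /forallP hM] /eqP defM] _] := maxsetP maxM.
(* With [y], the set [M] would contain [B] and be closed. For [j] in [R] generating [C], the premise
   is [A] and the conclusion already lies in [Q]; for other [j] with premise in [M],
   quasi-closedness of [M] applies. *)
apply: contra MN => yM; rewrite memF; apply/andP; split.
  apply/implyP => _ /=; rewrite -(setD1K yB) subUset sub1set yM /=.
  exact: subset_trans ByQ QM'.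
apply/modelsP => j jR jM.
have jC : clos F j.1 \subset C by rewrite -defM closS.
have [eqC|neC] := eqVneq (clos F j.1) C.
  have /modelsP/(_ j jR) := QR; rewrite (exR j jR) eqC -defA => /(_ AQ) sub.
  exact: subset_trans sub QM'.
have := hM j.1; rewrite jM defM properEneq neC jC /=; apply: subset_trans.
have : clos F j.1 \in F by exact: clos_in.
by rewrite memF => /andP[_ /modelsP/(_ j jR (sub_clos _ _))].
Qed.

Hypothesis triv : {in F, forall C, trivIset (qc_edges F C)}.

(** The invariant says that processed implications are tight and that their closures differ from
    each other and from those still unread. It persists because saturated implications with equal
    closures coincide: an implication with a copy still unread is redundant and gets dropped. *)
Lemma prune_optimum D T :
    is_base F (D ++ T) -> all saturated T ->
    {in D, forall i, i.1 = ex F (clos F i.1)} -> {in D, forall i, tight i} ->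
    uniq [seq clos F i.1 | i <- D] ->
    {in D & T, forall i j, clos F i.1 <> j.2} ->
  optimum_base F (prune D T).
Proof.
elim: T D => [|i T IHT] D /= base.
  move=> _ _ tD uD _; rewrite cats0 in base; split=> // S baseS.
  apply: leq_trans (sum_partition_leq (fun j => clos F j.1) S
                      (fun j => #|j.1| + #|j.2|) uD).
  by rewrite big_map /total_size !big_seq; apply: leq_sum => j jD; apply: tD.
case/andP=> sati satT exD tD uD sep.
have memR : catrev D T =i D ++ T.
  by move=> j; rewrite catrevE !mem_cat mem_rev.
have baseR : is_base F (i :: catrev D T).
  rewrite base; apply: (@eq_models (D ++ i :: T)) => j.
  by rewrite inE memR !mem_cat inE; do !case: (_ \in _) => //=; rewrite ?orbT.
have closi : clos F i.1 = i.2.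
  by case/andP: sati => iF /eqP->; rewrite (clos_ex hF).
have exT j : j \in T -> clos F j.1 = j.2 /\ j.1 = ex F j.2.
  by move=> /(allP satT)/andP[jF /eqP->]; rewrite (clos_ex hF).
case: ifPn => [red|nred].
  apply: IHT => //; last by move=> j k jD kT; apply: sep; rewrite // inE kT orbT.
  by rewrite (prune_redundant baseR red); apply: eq_models.
have exR : {in catrev D T, forall j, j.1 = ex F (clos F j.1)}.
  move=> j; rewrite memR mem_cat => /orP[/exD//|/exT[-> ->]] //.
have iF : i.2 \in F by case/andP: sati.
have [base' tight'] := prune_reduce baseR sati (triv iF) exR nred.
set B := greedy _ _ in base' tight' *.
apply: IHT => //=.
- rewrite base'; apply: eq_models => j; by rewrite !inE memR.
- move=> j; rewrite inE => /orP[/eqP->|/exD] //=.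
  by rewrite closi; case/andP: sati => _ /eqP.
- by move=> j; rewrite inE => /orP[/eqP->|/tD].
- rewrite uD andbT closi; apply/mapP => -[j jD eqj].
  by apply: (sep j i jD); rewrite ?mem_head.
- move=> j k; rewrite inE => /orP[/eqP-> kT|jD kT]; last first.
    by apply: sep; rewrite // inE kT orbT.
  rewrite /= closi => eqk; case/negP: nred; have [_ ek] := exT k kT.
  have ik : i = k.
    by case/andP: sati => _ /eqP; case: (i) (k) ek eqk => [? ?] [? ?] /= -> -> ->.
  have iR : i \in catrev D T by rewrite memR mem_cat ik kT orbT.
  have := clos_in i.1 (models_closure_system (catrev D T)).
  by move=> /modelsP/(_ i iR); apply; apply: sub_clos.
Qed.

Lemma optimize_optimum L : is_base F L -> optimum_base F (optimize L).
Proof.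
move=> baseL; rewrite /optimize.
have -> : foldl (fun acc i => saturate L i :: acc) [::] L =
    rev [seq saturate L i | i <- L].
  rewrite -[RHS]cats0 -catrevE.
  by elim: {2 4}L [::] => //= i s IHs acc.
apply: prune_optimum => //; first exact: is_base_saturate.
apply/allP => j; rewrite mem_rev => /mapP[i iL ->].
by case: (saturate_saturated baseL iL).
Qed.

End Geometry.
End Optimality.

Theorem theorem3 (R : realType) :
  (forall (U : finType) (F : {set {set U}}),
     listed_convex_geometry R F ->
     forall C : {set U}, essential F C -> trivIset (qc_edges F C)) /\
  optimizable_in_poly_time (fun U F => @listed_convex_geometry R U F).
Proof.
split=> [U F hF C /andP[CF _]|]; first exact: listed_trivIset hF CF.
have [c [m [k hc]]] := polytime_toptimize.
pose p : {poly nat} := (('X + 2%:R%:P) ^+ k)%R.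
have bdE n : bd k n = p.[n]%R.
  by rewrite horner_exp hornerD hornerX hornerC !natrE addn2.
exists c, p => U F S hF baseS.
have [[t [s [run le_t [s0 _]]]] le_size] :=
  hc (update (fun=> Defs.Nil) 0 (enc_base S)).
exists (optimize S), t; split.
- by apply: optimize_optimum baseS; [case: hF|move=> C; apply: listed_trivIset hF].
- by exists s; rewrite s0 toptimize_enc.
- by rewrite -bdE.
- by rewrite -bdE -toptimize_enc.
Qed.
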